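(* There exist an absolute constant $C>0$ and $\beta_0>0$ such that for every $\beta\ge\beta_0$, with $\lambda=\lambda_w=-\log(1-e^{-4\beta})$ and $h_n^*=\lfloor \frac{1}{6\beta}\log n+\frac13\rfloor$, $$\lim_{n\to\infty}\mathbb P\Big(\big|\{x\in\Lambda_n:\ \phi_x\notin\{h_n^*-1,h_n^*\}\}\big|\le \frac{C}{\beta}n^2\Big)=1 ,$$ where $\phi$ is the SOS height function on $\Lambda_n$ above a hard floor with zero boundary condition and pinning parameter $\lambda$.
   Context: Let $\Lambda_n=\{-\lfloor n/2\rfloor,\ldots,\lfloor n/2\rfloor\}^2\subset\mathbb Z^2$, and write $x\sim y$ for nearest neighbors in $\mathbb Z^2$. For $\beta>0$ and $\lambda>0$, $\mathbb P=\mathbb P_{n,\beta,\lambda}$ is the probability measure on height functions $\phi:\Lambda_n\to\mathbb Z_{\ge0}$ given by $$\mathbb P(\phi)\propto \exp\Big(-\beta\sum_{x\sim y}|\phi_x-\phi_y|+\lambda\sum_{x\in\Lambda_n}\mathbf 1_{\{\phi_x=0\}}\Big),$$ where $\phi$ is extended to be $0$ on the outer vertex boundary $\partial\Lambda_n$ of $\Lambda_n$, and the first sum runs over all nearest-neighbor (unordered) pairs with at least one endpoint in $\Lambda_n$. *)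

(* Defs.v *)
From HB Require Import structures.
From mathcomp Require Import all_boot all_order all_algebra.
From mathcomp Require Import all_classical all_reals all_analysis.

Set Implicit Arguments.
Unset Strict Implicit.
Unset Printing Implicit Defensive.

Import Order.TTheory GRing.Theory Num.Theory.
Import numFieldNormedType.Exports.

Local Open Scope ring_scope.

Definition site : Type := (int * int)%type.

Definition zrange (r : nat) : seq int :=
  [seq k%:Z - r%:Z | k <- iota 0 r.*2.+1].

Definition box (r : nat) : seq site :=
  [seq (a, b) | a <- zrange r, b <- zrange r].

Definition Lambda (n : nat) : seq site := box n./2.

Definition nn (x y : site) : bool :=
  `|x.1 - y.1| + `|x.2 - y.2| == 1.

(* Each unordered nearest-neighbor pair meeting [Lambda n] occurs exactly once:
   it is listed with its lexicographically smaller endpoint first.  Both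
   endpoints of such a pair lie in the box of radius one larger. *)
Definition bonds (n : nat) : seq (site * site) :=
  [seq e <- [seq (x, y) | x <- box n./2.+1, y <- box n./2.+1]
   | [&& nn e.1 e.2,
         (e.1.1 < e.2.1) || (e.1.1 == e.2.1) && (e.1.2 < e.2.2)
       & (e.1 \in Lambda n) || (e.2 \in Lambda n)]].

Definition height (n : nat) : Type := {ffun seq_sub (Lambda n) -> nat}.

Definition extend0 (n : nat) (phi : height n) (x : site) : nat :=
  if insub x is Some y then phi y else 0%N.

Definition sos_energy (n : nat) (phi : height n) : nat :=
  (\sum_(e <- bonds n)
     absz ((extend0 phi e.1)%:Z - (extend0 phi e.2)%:Z)%R)%N.

Definition zeros (n : nat) (phi : height n) : nat :=
  #|[pred x | phi x == 0%N]|.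

Definition sos_weight (R : realType) (n : nat) (beta lambda : R)
    (phi : height n) : R :=
  expR (- beta * (sos_energy phi)%:R + lambda * (zeros phi)%:R).

Definition sos_mass (R : realType) (n : nat) (beta lambda : R)
    (A : set (height n)) : \bar R :=
  (\esum_(phi in A) (sos_weight beta lambda phi)%:E)%E.

(* For [beta > 0] the partition function [sos_mass beta lambda setT] is a
   positive real, so that [fine] loses nothing. *)
Definition sos_prob (R : realType) (n : nat) (beta lambda : R)
    (A : set (height n)) : R :=
  fine (sos_mass beta lambda A) / fine (sos_mass beta lambda [set: height n]).

Definition lambda_w (R : realType) (beta : R) : R :=
  - ln (1 - expR (- (4 * beta))).

Definition hstar (R : realType) (beta : R) (n : nat) : int :=
  Num.floor (1 / (6 * beta) * ln n%:R + 1 / 3).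

(* Main.v *)
(* Extend the surface to heights psi : box -> Z with phi = psi^+.  Since
   e^{lambda_w} = sum_k e^{-4 beta k}, the pinned measure is the image of the
   measure with bond weights exp(-beta (|psi_x - psi_y| + 2 min(psi_x^-, psi_y^-))):
   a free surface in which only adjacent negative heights are penalised.  The first
   configuration that feels the floor is therefore a dimer, of cost e^{-6 beta h}
   from level h, instead of a single site, of cost e^{-4 beta h}.

   Upper tail: lowering by one the inside U of an outermost contour of level
   h = h* + 1 gains e^{-beta |dU|} and loses at most the exponential of
   8 beta e^{-6 beta h} |U|.  As |U| is at most n |dU| and n e^{-6 beta h} is at most
   e^{-2 beta}, the loss is dominated, and a Peierls sum over families of contours
   bounds an exponential moment of the area at level h.

   Lower tail: raising the whole surface by one costs e^{4 beta n}.  On a flat piece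
   at height at most h* - 2 the raised surface may then be dug down to zero on any
   dimer at cost e^{-6 beta (h* - 1)}, which is at least e^{4 beta} / n; if these
   pieces have area of order n^2 / beta the entropy gained, of order
   e^{4 beta} n / beta, beats 4 beta n.  The surface is flat at all but O(n^2 / beta)
   sites because its energy is that small. *)

Require Import Defs.
From HB Require Import structures.
From mathcomp Require Import all_boot all_order all_algebra.
From mathcomp Require Import all_classical all_reals all_analysis.
From mathcomp Require Import zify ring lra.
Import Order.TTheory GRing.Theory Num.Theory.
Import numFieldNormedType.Exports.

Set Implicit Arguments.
Unset Strict Implicit.
Unset Printing Implicit Defensive.

Local Open Scope ring_scope.

(** * Contours on the square lattice *)

(* The edge from a site to its right ([true]) or upper ([false]) neighbor. *)
Notation edge := (site * bool)%type.

(** The estimate for a low dimer climbs one level at a time from 0 to [h]. As [h] grows like log n,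
    a constant factor lost at each level would become a power of n and spoil the exponent 6. So the
    main term of one step is a single injective map, without a sum over contours; only the
    exceptional case of a third low site uses such a sum, which it can afford since the contour has
    8 edges and 7 are needed. The number of bonds pushed below the floor by a lowering is random,
    but only its mean is needed, since Jensen's inequality goes in the right direction. Contours are
    lowered in families because the exponential moment expands over subfamilies; outermost contours
    have disjoint boundaries, so the gains add. In the lower tail the surface must be recovered from
    its image and the set of dug dimers. Flatness makes an erased height readable at the site to the
    left, and residues mod 3 keep that site undug. Raising first removes the old zeros: a zero dimer
    of the image was either dug or at height -1, and in the latter case raising regains the penalty
    of its bond. *)

Definition xco (x : site) : int := x.1.
Definition yco (x : site) : int := x.2.
Arguments xco !x /.
Arguments yco !x /.

Definition stp (x : site) (b : bool) : site :=
  if b then (xco x + 1, yco x) else (xco x, yco x + 1).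
Arguments stp : simpl never.

Lemma xco_stp x b : xco (stp x b) = if b then xco x + 1 else xco x.
Proof. by case: b. Qed.

Lemma yco_stp x b : yco (stp x b) = if b then yco x else yco x + 1.
Proof. by case: b. Qed.

Definition stpE := (xco_stp, yco_stp).

Definition cross (P : pred site) (e : edge) : bool :=
  P e.1 (+) P (stp e.1 e.2).

Definition nb (x y : site) : Prop :=
  (exists b, y = stp x b) \/ (exists b, x = stp y b).

Definition inbox (r : nat) (x : site) : bool :=
  (`|xco x| <= r%:Z) && (`|yco x| <= r%:Z).

Lemma mem_zrange r k : (k \in zrange r) = (`|k| <= r%:Z).
Proof.
apply/mapP/idP => [[i]|kr].
  by rewrite mem_iota => ir ->; lia.
by exists (absz (k + r%:Z)%R); [rewrite mem_iota; lia|lia].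
Qed.

Lemma mem_box r x : (x \in box r) = inbox r x.
Proof.
case: x => a b; rewrite /inbox /= -!mem_zrange.
by apply/allpairsP/andP => [[[c d] /= [? ? [-> ->]]]|[? ?]] //; exists (a, b).
Qed.

(** The half-plane to the right of the box stands for infinity, reached by a path outside [A]. Thus
    [hull] fills the holes of [A], and [coconn] says that there are none. *)
Inductive esc (r : nat) (A : pred site) : site -> Prop :=
| esc_right x of r%:Z < xco x & ~~ A x : esc r A x
| esc_step x y of ~~ A x & nb x y & esc r A y : esc r A x.

Definition hull (r : nat) (A : pred site) : pred site :=
  fun x => ~~ `[< esc r A x >].

Definition coconn (r : nat) (U : pred site) : Prop :=
  forall x, ~~ U x -> esc r U x.

Lemma nbC x y : nb x y -> nb y x.
Proof. by case; [right|left]. Qed.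

Lemma hullPn r A x : ~~ hull r A x <-> esc r A x.
Proof. by rewrite negbK; split=> /asboolP. Qed.

Lemma esc_out r A x : esc r A x -> ~~ A x.
Proof. by case. Qed.

Lemma sub_hull r (A : pred site) x : A x -> hull r A x.
Proof. by apply: contraTT => /hullPn/esc_out. Qed.

Lemma hull_boundary r (A : pred site) x y : nb x y -> hull r A x -> ~~ hull r A y -> A x.
Proof.
move=> xy hx /hullPn hy; apply: contraLR hx => Ax.
by apply/hullPn; exact: esc_step xy hy.
Qed.

Lemma esc_mono r (A B : pred site) x :
  {subset A <= B} -> esc r B x -> esc r A x.
Proof.
move=> AB; have AB' z : ~~ B z -> ~~ A z by apply: contra => /AB.
elim=> {x} [x xr /AB' Ax|x y /AB' Ax xy _]; first exact: esc_right.
exact: esc_step.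
Qed.

Lemma hull_min r (A U : pred site) x :
  {subset A <= U} -> coconn r U -> hull r A x -> U x.
Proof.
by move=> AU cU; apply: contraTT => /cU Ux; apply/hullPn; exact: esc_mono Ux.
Qed.

Lemma coconn_inbox r : coconn r (inbox r).
Proof.
have horiz (x : site) : r%:Z < `|yco x| -> esc r (inbox r) x.
  move: {2}(absz (r%:Z + 1 - xco x)%R) (erefl ((absz (r%:Z + 1 - xco x)%R))) => k.
  elim: k x => [|k IH] x kE xr.
    by apply: esc_right; rewrite /inbox; lia.
  have [rx|xr'] := ltP r%:Z (xco x); first by apply: esc_right; rewrite /inbox; lia.
  apply: (@esc_step _ _ _ (stp x true)); first by rewrite /inbox; lia.
    by left; exists true.
  by apply: IH; rewrite stpE; lia.
have vert (x : site) : r%:Z < `|xco x| -> esc r (inbox r) x.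
  move: {2}(absz (r%:Z + 1 - yco x)%R) (erefl ((absz (r%:Z + 1 - yco x)%R))) => k.
  elim: k x => [|k IH] x kE xr; first by apply: horiz; lia.
  have [rx|xr'] := ltP r%:Z (yco x); first by apply: horiz; lia.
  apply: (@esc_step _ _ _ (stp x false)); first by rewrite /inbox; lia.
    by left; exists false.
  by apply: IH; rewrite stpE; lia.
move=> x; rewrite /inbox negb_and -!ltNge => /orP[]; [exact: vert|exact: horiz].
Qed.

Lemma hull_inbox r (A : pred site) x :
  {subset A <= inbox r} -> hull r A x -> inbox r x.
Proof. by move=> Ar; apply: hull_min Ar (@coconn_inbox r). Qed.

(* The edges around the face with lower-left corner [p]: two edges sharing a face are
   dual edges sharing an endpoint. *)
Definition plaq (p : site) : seq edge :=
  [:: (p, true); (p, false); (stp p false, true); (stp p true, false)].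

Definition eadj (e f : edge) : Prop :=
  exists p, e \in plaq p /\ f \in plaq p.

Inductive econn (Q : pred edge) (e : edge) : edge -> Prop :=
| econn_refl : econn Q e e
| econn_step f g of econn Q e f & Q g & eadj f g : econn Q e g.

Lemma eadjC e f : eadj e f -> eadj f e.
Proof. by case=> p []; exists p. Qed.

Lemma econn_trans Q e f g : econn Q e f -> econn Q f g -> econn Q e g.
Proof.
by move=> ef; elim=> // {}g g' fg IH Qg' gg'; exact: econn_step IH Qg' gg'.
Qed.

Lemma econn_sym (Q : pred edge) e f : Q e -> econn Q e f -> econn Q f e.
Proof.
move=> Qe; suff: econn Q e f -> Q f /\ econn Q f e by move=> h /h[].
elim=> [|{}f g ef [Qf IH] Qg fg]; first by split=> //; exact: econn_refl.
split=> //; apply: econn_trans IH.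
by apply: econn_step (econn_refl _ _) Qf _; exact: eadjC.
Qed.

Lemma econnQ (Q : pred edge) e f : Q e -> econn Q e f -> Q f.
Proof. by move=> Qe; case. Qed.

Definition comp (Q : pred edge) (e : edge) : pred edge :=
  fun f => `[< econn Q e f >].

(** A face is a vertex of the dual lattice; this says that every dual degree is even, so that [Q] is
    a union of closed dual curves. *)
Definition even_plaq (Q : pred edge) : Prop :=
  forall p, ~~ (Q (p, true) (+) Q (p, false)
             (+) Q (stp p false, true) (+) Q (stp p true, false)).

Lemma stpC p a b : stp (stp p a) b = stp (stp p b) a.
Proof. by case: a b => -[]. Qed.

Lemma even_plaq_cross P : even_plaq (cross P).
Proof.
move=> p; rewrite /cross /= [stp (stp p true) false]stpC.
by do 4 case: (P _).
Qed.

Lemma comp_plaq (Q : pred edge) e p f g : f \in plaq p -> g \in plaq p ->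
  comp Q e f -> Q g -> comp Q e g.
Proof.
move=> fp gp /asboolP ef Qg; apply/asboolP.
by apply: econn_step ef Qg _; exists p.
Qed.

(** The edges of [Q] around one face are mutually adjacent, so a component contains all of them or
    none. *)
Lemma even_plaq_comp (Q : pred edge) e : Q e -> even_plaq Q -> even_plaq (comp Q e).
Proof.
move=> Qe ev p.
have sub f : comp Q e f -> Q f by move=> /asboolP; exact: econnQ.
have [/hasP[f fp cf]|/hasPn h] := boolP (has (comp Q e) (plaq p)).
  have E g : g \in plaq p -> comp Q e g = Q g.
    move=> gp; apply/idP/idP; first exact: sub.
    exact: comp_plaq fp gp cf.
  by rewrite !E ?ev// !inE eqxx ?orbT.
by rewrite !(negbTE (h _ _))// !inE eqxx ?orbT.
Qed.

Fixpoint ray (Q : pred edge) (k : nat) (x : site) : bool :=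
  if k is k'.+1 then Q (x, true) (+) ray Q k' (stp x true) else false.

(* The parity of the number of edges of [Q] on the ray going right from [x]. *)
Definition inside (r : nat) (Q : pred edge) (x : site) : bool :=
  if xco x <= r%:Z then ray Q (absz (r%:Z + 1 - xco x)%R) x else false.

Section Inside.
Variables (r : nat) (Q : pred edge).
Hypothesis Qbox : forall e, Q e -> inbox r e.1 || inbox r (stp e.1 e.2).
Hypothesis Qeven : even_plaq Q.

Lemma inside_right (x : site) : r%:Z < xco x -> inside r Q x = false.
Proof. by rewrite /inside leNgt => ->. Qed.

Lemma Q_right (x : site) b : r%:Z < xco x -> Q (x, b) = false.
Proof.
move=> rx; apply/negP => /Qbox; rewrite /inbox /= !stpE.
by case: b; lia.
Qed.

Lemma inside_step x : inside r Q x = Q (x, true) (+) inside r Q (stp x true).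
Proof.
have [xr|rx] := leP (xco x) r%:Z; last first.
  by rewrite Q_right// !inside_right// stpE; lia.
rewrite {1}/inside xr; have [k kE] : exists k, (absz (r%:Z + 1 - xco x)%R) = k.+1.
  by exists (absz (r%:Z - xco x)%R); lia.
rewrite kE /=; congr (_ (+) _).
rewrite /inside stpE; have [h|h] := leP (xco x + 1) r%:Z.
  by congr (ray _ _ _); lia.
by have -> : k = 0%N by lia.
Qed.

(** A discrete Jordan theorem. Horizontal edges are right by construction of the ray parity. For a
    vertical edge the parities of two consecutive rows are compared from the far right leftwards,
    evenness at each face carrying the induction. *)
Lemma cross_inside e : cross (inside r Q) e = Q e.
Proof.
case: e => x [].
  by rewrite /cross /= inside_step; case: (Q _); case: inside.
rewrite /cross /=.
move: {2}(absz (r%:Z + 1 - xco x)%R) (erefl ((absz (r%:Z + 1 - xco x)%R))) => k.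
elim: k x => [|k IH] x kE.
  by have rx : r%:Z < xco x by [lia]; rewrite !inside_right ?Q_right// stpE.
have [rx|xr] := ltP r%:Z (xco x); first by rewrite !inside_right ?Q_right// stpE.
have H := IH (stp x true); move: H; rewrite stpE.
have -> : absz (r%:Z + 1 - (xco x + 1))%R = k by lia.
move=> /(_ erefl) H; move: (Qeven x).
rewrite inside_step [inside r Q (stp x false)]inside_step [stp (stp x false) _]stpC -H /=.
by do 3 case: (Q _); case: (inside _ _ _); case: (inside _ _ _).
Qed.

End Inside.

Section Contours.
Variables (r : nat) (A : pred site).
Hypothesis Abox : {subset A <= inbox r}.

Let H := hull r A.

(** Components are taken in the boundary of the hull, not of [A], so only outermost contours
    appear. *)
Definition contour (e : edge) : pred site := inside r (comp (cross H) e).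

Lemma cross_hull_box e : cross H e -> inbox r e.1 || inbox r (stp e.1 e.2).
Proof.
rewrite /cross; case h1 : (H e.1) => /=; first by rewrite (hull_inbox Abox h1).
by move=> h2; rewrite (hull_inbox Abox h2) orbT.
Qed.

Lemma cross_contour e f : cross H e ->
  cross (contour e) f = comp (cross H) e f.
Proof.
move=> He; apply: cross_inside.
  by move=> g /asboolP/(econnQ He)/cross_hull_box.
exact: even_plaq_comp He (@even_plaq_cross _).
Qed.

Lemma cross_contour_hull e f : cross H e -> cross (contour e) f -> cross H f.
Proof. by move=> He; rewrite cross_contour// => /asboolP/(econnQ He). Qed.

Lemma contour_const e x y : cross H e -> nb x y -> H x = H y ->
  contour e x = contour e y.
Proof.
move=> He xy Hxy; case: xy => -[b E].
  have := @cross_contour_hull e (x, b) He; rewrite /cross /= -E Hxy addbb.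
  by case: (contour e x) (contour e y) => -[] // /(_ isT).
have := @cross_contour_hull e (y, b) He; rewrite /cross /= -E Hxy addbb.
by case: (contour e x) (contour e y) => -[] // /(_ isT).
Qed.

(** An escaping path crosses no boundary edge of the hull, so the parity keeps the value [false]
    that it has at infinity. *)
Lemma contour_sub_hull e x : cross H e -> contour e x -> H x.
Proof.
move=> He; apply: contraTT => /hullPn; elim=> {x} [x rx _|x y Ax xy ey IH].
  by rewrite /contour inside_right.
have Hx : H x = false by apply/negbTE/hullPn; exact: esc_step xy ey.
have Hy : H y = false by apply/negbTE/hullPn.
by rewrite (contour_const He xy) ?Hx ?Hy.
Qed.

Lemma contour_boundary e x y : cross H e -> nb x y ->
  contour e x -> ~~ contour e y -> A x /\ ~~ H y.
Proof.
move=> He xy Vx Vy; have Hx := contour_sub_hull He Vx.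
have Hy : ~~ H y.
  by apply: contraNN Vy => Hy; rewrite -(contour_const He xy)// Hx Hy.
by split=> //; exact: hull_boundary Hy.
Qed.

(** Walk right from [x] until the hull is left: the inside of the contour through that exit edge
    contains the last hull site, hence [x], since no boundary edge was crossed before. *)
Lemma contour_cover x : H x -> exists2 e, cross H e & contour e x.
Proof.
move=> Hx; have xr := hull_inbox Abox Hx.
have: xco x <= r%:Z by move: xr; rewrite /inbox; lia.
move: {2}(absz (r%:Z + 1 - xco x)%R) (erefl ((absz (r%:Z + 1 - xco x)%R))) => k.
elim: k x Hx {xr} => [|k IH] x Hx kE xr; first by lia.
have [Hy|Hy] := boolP (H (stp x true)).
  have yr := hull_inbox Abox Hy.
  have [||e He Ve] := IH _ Hy; rewrite ?stpE; first by lia.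
    by move: yr; rewrite /inbox !stpE; lia.
  exists e => //; rewrite (contour_const He (y := stp x true)) ?Hx ?Hy//.
  by left; exists true.
have He : cross H (x, true) by rewrite /cross /= Hx (negbTE Hy).
exists (x, true) => //.
have : cross (contour (x, true)) (x, true).
  by rewrite cross_contour//; apply/asboolP; exact: econn_refl.
rewrite /cross /=; have /negbTE -> // : ~~ contour (x, true) (stp x true).
  by apply: contraNN Hy => /(contour_sub_hull He).
by rewrite addbF.
Qed.

Lemma contour_econn e f : cross H e -> cross (contour e) f ->
  econn (cross (contour e)) e f.
Proof.
move=> He; rewrite cross_contour// => /asboolP; elim=> {f} [|g g' eg IH Hg gg'].
  exact: econn_refl.
apply: (econn_step IH _ gg'); rewrite cross_contour//; apply/asboolP.
exact: econn_step eg Hg gg'.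
Qed.

Lemma contour_eq_or_disjoint e f : cross H e -> cross H f ->
  contour e =1 contour f \/
  forall g, ~~ (cross (contour e) g && cross (contour f) g).
Proof.
move=> He Hf; have [[g]|/forallNP h] := pselect (exists g,
    cross (contour e) g && cross (contour f) g); last first.
  by right=> g; apply/negP; exact: h.
rewrite !cross_contour// => /andP[/asboolP eg /asboolP fg]; left=> x.
suff E : comp (cross H) e = comp (cross H) f by rewrite /contour E.
have ef := econn_trans eg (econn_sym Hf fg).
apply/funext => k; apply/asboolP/asboolP; apply: econn_trans => //.
exact: econn_sym.
Qed.

End Contours.

(** * Counting contours *)

Lemma sum_nat_of_bool (I : finType) (P : pred I) :
  (\sum_(i : I) P i)%N = #|[set i | P i]|.
Proof.
by rewrite -sum1_card [RHS]big_mkcond; apply: eq_bigr => i _; rewrite inE; case: (P i).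
Qed.

Lemma leq_card_rel (X Y : finType) (A : {set X}) (B : {set Y})
    (rel : X -> Y -> Prop) :
  (forall x, x \in A -> exists2 y, y \in B & rel x y) ->
  (forall x x' y, x \in A -> x' \in A -> rel x y -> rel x' y -> x = x') ->
  (#|A| <= #|B|)%N.
Proof.
move=> tot inj; have [->|[x0 x0A]] := set_0Vmem A; first by rewrite cards0.
have [y0 y0B _] := tot _ x0A.
have /choice[f fP] : forall x, exists y, x \in A -> y \in B /\ rel x y.
  move=> x; have [xA|xA] := boolP (x \in A); last by exists y0.
  by have [y yB xy] := tot _ xA; exists y.
rewrite -(card_in_imset (f := f)) => [|x x' xA x'A fxx'].
  by apply/subset_leq_card/fintype.subsetP => _ /imsetP[x xA ->]; have [] := fP _ xA.
apply: (inj x x' (f x)) => //; first by have [] := fP _ xA.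
by rewrite fxx'; have [] := fP _ x'A.
Qed.

(** * Walks covering a connected set *)

Section CoveringWalk.
Variables (E : eqType) (L : Type) (step : E -> L -> E).
Hypothesis step_sym : forall e l, exists l', step (step e l) l' = e.
Hypothesis step_id : forall e, exists l, step e l = e.

Inductive rconn (s : seq E) (e : E) : E -> Prop :=
| rconn_refl : rconn s e e
| rconn_step f l of rconn s e f & step f l \in s : rconn s e (step f l).

Definition visited (e : E) (w : seq L) : seq E := e :: scanl step e w.

Lemma visited_split e w g : g \in visited e w ->
  exists w1 w2, w = w1 ++ w2 /\ foldl step e w1 = g.
Proof.
elim: w e => [|l w IH] e; rewrite /visited /= inE.
  by move=> /eqP->; exists [::], [::].
move=> /orP[/eqP->|]; first by exists [::], (l :: w).
by move=> /IH[w1 [w2 [-> <-]]]; exists (l :: w1), w2.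
Qed.

Lemma visited_cat e w1 w2 :
  visited e (w1 ++ w2) =i visited e w1 ++ visited (foldl step e w1) w2.
Proof.
move=> g; rewrite /visited /= !inE scanl_cat !mem_cat inE.
have h : foldl step e w1 \in e :: scanl step e w1.
  elim: w1 e => [|l w IH] e /=; first by rewrite inE.
  by rewrite inE IH orbT.
have [->|] := eqVneq g (foldl step e w1); last by rewrite /= orbA.
by move: h; rewrite inE orTb !orbT orbA => ->.
Qed.

Lemma covering_walk (s : seq E) e : uniq s -> e \in s ->
  (forall f, f \in s -> rconn s e f) ->
  exists w, size w = (size s).*2 /\ visited e w =i s.
Proof.
move=> us es sc; have [l0 l0E] := step_id e.
have pad w : visited e [:: l0, l0 & w] =i visited e w.
  by move=> g; rewrite /visited /= !l0E !inE; case: (g == e).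
(* As in a depth-first search, an excursion to a new element and back is inserted at a visited one;
   it adds two letters and keeps the walk closed. If enough elements are already visited, two idle
   letters pad the word, whose length must be exact to count words. *)
have main j : (j < size s)%N -> exists w, [/\ size w = j.*2,
    {subset visited e w <= s}, foldl step e w = e &
    (j < size (undup (visited e w)))%N].
  elim: j => [|j IH] js.
    exists [::]; split=> //= g; rewrite inE => /eqP->; exact: es.
  have [w [sw ws we jw]] := IH (ltnW js).
  have [jw'|jw'] := ltnP j.+1 (size (undup (visited e w))).
    exists [:: l0, l0 & w]; split.
    - by rewrite /= sw.
    - by move=> g; rewrite pad; exact: ws.
    - by rewrite /= !l0E.
    - by rewrite (perm_size (perm_undup (pad w))).
  have [g gw [l ls lw]] : exists2 g, g \in visited e w &
      exists2 l, step g l \in s & step g l \notin visited e w.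
    apply/not_exists2P => h.
    suff : {subset s <= undup (visited e w)}.
      by move=> /(uniq_leq_size us); move: jw' js; lia.
    move=> f /sc; rewrite mem_undup; elim=> [|{}f l _ fw fls].
      by rewrite /visited inE eqxx.
    have [//|hg] := h f; apply/negPn/negP => nw; apply: hg.
    by exists l.
  have [w1 [w2 [wE w1g]]] := visited_split gw.
  have [l' l'E] := step_sym g l.
  have vE : visited e (w1 ++ [:: l, l' & w2]) =i step g l :: visited e w.
    move=> f; rewrite wE !visited_cat inE !visited_cat !mem_cat w1g.
    rewrite /visited /= l'E !inE.
    by case: (f == g); case: (f == e); case: (f == step g l);
      rewrite ?orbT ?orbF //=.
  exists (w1 ++ [:: l, l' & w2]); split.
  - by move: sw; rewrite wE !size_cat /=; lia.
  - by move=> f; rewrite vE inE => /orP[/eqP->//|/ws].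
  - by move: we; rewrite wE !foldl_cat /= w1g l'E.
  - have : {subset step g l :: undup (visited e w) <=
              undup (visited e (w1 ++ [:: l, l' & w2]))}.
      by move=> f; rewrite mem_undup vE !inE mem_undup.
    have us' : uniq (step g l :: undup (visited e w)).
      by rewrite cons_uniq mem_undup lw undup_uniq.
    by move=> /(uniq_leq_size us'); apply: leq_trans; rewrite /= ltnS.
have s0 : (0 < size s)%N by case: (s) es.
have [|w [sw ws we jw]] := main (size s).-1; first by rewrite prednK.
exists [:: l0, l0 & w]; split; first by rewrite /= sw; lia.
move=> g; rewrite pad.
have [||_ <-] := @uniq_min_size _ (undup (visited e w)) s (undup_uniq _).
- by move=> f; rewrite mem_undup; exact: ws.
- by move: jw; rewrite prednK.
- by rewrite mem_undup.
Qed.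

End CoveringWalk.

Definition bstp (x : site) (b : bool) : site :=
  if b then (xco x - 1, yco x) else (xco x, yco x - 1).
Arguments bstp : simpl never.

Lemma bstpK b : cancel (stp^~ b) (bstp^~ b).
Proof. by case: b => -[u v]; rewrite /stp /bstp /= addrK. Qed.

Lemma stpK b : cancel (bstp^~ b) (stp^~ b).
Proof. by case: b => -[u v]; rewrite /stp /bstp /= subrK. Qed.

Lemma xco_iter_stp k b y :
  xco (iter k (stp^~ b) y) = if b then xco y + k%:Z else xco y.
Proof.
elim: k => [|k IH]; first by rewrite addr0; case: b.
by rewrite iterS stpE IH; case: (b); lia.
Qed.

Lemma yco_iter_stp k b y :
  yco (iter k (stp^~ b) y) = if b then yco y else yco y + k%:Z.
Proof.
elim: k => [|k IH]; first by rewrite addr0; case: b.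
by rewrite iterS stpE IH; case: (b); lia.
Qed.

Lemma xco_iter_bstp k b y :
  xco (iter k (bstp^~ b) y) = if b then xco y - k%:Z else xco y.
Proof.
elim: k => [|k IH]; first by rewrite subr0; case: b.
by rewrite iterS; move: IH; rewrite {2}/bstp; case: (b) => /=; lia.
Qed.

Lemma yco_iter_bstp k b y :
  yco (iter k (bstp^~ b) y) = if b then yco y else yco y - k%:Z.
Proof.
elim: k => [|k IH]; first by rewrite subr0; case: b.
by rewrite iterS; move: IH; rewrite {2}/bstp; case: (b) => /=; lia.
Qed.

Lemma site_eq (u v : site) : xco u = xco v -> yco u = yco v -> u = v.
Proof. by case: u v => a b [c d] /= -> ->. Qed.

Definition letter : finType := (bool * 'I_4)%type.

(** The flag selects one of the two faces next to [e], the index one of its four edges, [e]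
    included; the default of [nth] is never reached. *)
Definition estep (e : edge) (l : letter) : edge :=
  nth e (plaq (if l.1 then e.1 else bstp e.1 (~~ e.2))) l.2.

Lemma eadj_estep e f : eadj e f <-> exists l, estep e l = f.
Proof.
split=> [[p [ep fp]]|[[s t] <-]].
  have [s sE] : exists s : bool, (if s then e.1 else bstp e.1 (~~ e.2)) = p.
    move: ep; rewrite /plaq !inE => /or4P[] /eqP ->; first by exists true.
    - by exists true.
    - by exists false; rewrite /= bstpK.
    - by exists false; rewrite /= bstpK.
  have := fp; rewrite -index_mem => h.
  by exists (s, Ordinal h); rewrite /estep /= sE nth_index.
exists (if s then e.1 else bstp e.1 (~~ e.2)); split; last exact: mem_nth.
case: e s => x [] [] /=; rewrite /plaq !inE ?eqxx ?orbT//.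
- by rewrite (stpK false x : stp (bstp x false) false = x) eqxx !orbT.
- by rewrite (stpK true x : stp (bstp x true) true = x) eqxx !orbT.
Qed.

Lemma eadj_refl e : eadj e e.
Proof. by case: e => x b; exists x; rewrite /plaq !inE; case: b; rewrite eqxx ?orbT. Qed.

(** * Boundary lengths and contour counts in a finite box *)

Section Box.
Variable r : nat.

Definition bsite : finType := seq_sub (box r).
Definition bedge : finType := (seq_sub (box r.+1) * bool)%type.

Definition ed (e : bedge) : edge := (val e.1, e.2).

Definition ins (V : {set bsite}) : pred site :=
  fun x => if insub x is Some y then y \in V else false.

Definition toset (P : pred site) : {set bsite} := [set y | P (val y)].

Definition bdy (V : {set bsite}) : {set bedge} := [set e | cross (ins V) (ed e)].

Lemma ed_inj : injective ed.
Proof. by move=> [e b] [f c] [/val_inj -> ->]. Qed.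

Lemma insE V y : ins V (val y) = (y \in V).
Proof. by rewrite /ins valK. Qed.

Lemma ins_inbox V x : ins V x -> inbox r x.
Proof.
rewrite /ins; case: insubP => // y.
by rewrite mem_box.
Qed.

Lemma inbox_val x : inbox r x -> exists y : bsite, val y = x.
Proof. by rewrite -mem_box => xr; exists (SeqSub xr). Qed.

Lemma ins_val V x : ins V x -> exists2 y, val y = x & y \in V.
Proof.
move=> Vx; have [y yx] := inbox_val (ins_inbox Vx).
by exists y => //; rewrite -insE yx.
Qed.

Lemma ins_toset P : {subset P <= inbox r} -> ins (toset P) =1 P.
Proof.
move=> Pr x; apply/idP/idP.
  by move=> /ins_val[y <-]; rewrite inE.
move=> Px; have [y yx] := inbox_val (Pr _ Px).
by rewrite -yx insE inE yx.
Qed.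

Lemma ins_inj V W : ins V =1 ins W -> V = W.
Proof. by move=> E; apply/setP => y; rewrite -!insE E. Qed.

Lemma ed_of e : inbox r e.1 || inbox r (stp e.1 e.2) -> exists f, ed f = e.
Proof.
case: e => x b /= h; have : x \in box r.+1.
  rewrite mem_box; move: h; rewrite /inbox !stpE; case: b; lia.
by move=> xr; exists (SeqSub xr, b).
Qed.

Lemma cross_ed V e : cross (ins V) e -> exists2 f, ed f = e & f \in bdy V.
Proof.
move=> Ve; have [|f fe] := @ed_of e; last by exists f; rewrite // inE fe.
move: Ve; rewrite /cross; case h : (ins V e.1); first by rewrite (ins_inbox h).
by move=> /= /ins_inbox ->; rewrite orbT.
Qed.

Lemma cross_ins_inj V W : cross (ins V) =1 cross (ins W) -> V = W.
Proof.
move=> E; apply: ins_inj => x.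
have : exists2 k : nat, ins V (iter k (stp^~ true) x) = false &
       ins W (iter k (stp^~ true) x) = false.
  have h k : xco (iter k (stp^~ true) x) = xco x + k%:Z.
    elim: k => [|k IH]; first by rewrite addr0.
    by rewrite iterS stpE IH; lia.
  exists (absz (r%:Z + 1 - xco x)%R); apply/negP => /ins_inbox;
    rewrite /inbox h; lia.
case=> k; elim: k x => [|k IH] x; first by move=> /= -> ->.
rewrite !iterSr => /IH/[apply]; move: (E (x, true)); rewrite /cross /=.
by do 2 case: (ins V _); do 2 case: (ins W _).
Qed.

Section Exits.
Variables (P : pred site) (Pr : {subset P <= inbox r}) (x : site).
Hypothesis Px : P x.

Lemma exit_fwd b : exists2 k, cross P (iter k (stp^~ b) x, b) &
  forall j, (j <= k)%N -> P (iter j (stp^~ b) x).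
Proof.
have ex : exists k, ~~ P (iter k (stp^~ b) x).
  exists (if b then absz (r%:Z + 1 - xco x)%R else absz (r%:Z + 1 - yco x)%R).
  apply/negP => /Pr; rewrite unfold_in /inbox xco_iter_stp yco_iter_stp.
  by case: b; lia.
case: (ex_minnP ex) => -[|k] Pk min; first by rewrite Px in Pk.
have lt j : (j <= k)%N -> P (iter j (stp^~ b) x).
  by move=> jk; apply: contraTT jk => /min; lia.
exists k => //; rewrite /cross /= lt//=.
Qed.

Lemma exit_bwd b : exists k, cross P (iter k.+1 (bstp^~ b) x, b).
Proof.
have ex : exists k, ~~ P (iter k (bstp^~ b) x).
  exists (if b then absz (r%:Z + 1 + xco x)%R else absz (r%:Z + 1 + yco x)%R).
  apply/negP => /Pr; rewrite unfold_in /inbox xco_iter_bstp yco_iter_bstp.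
  by case: b; lia.
case: (ex_minnP ex) => -[|k] Pk min; first by rewrite Px in Pk.
exists k; rewrite /cross (negbTE Pk) /= stpK.
by apply: contraTT (ltnSn k) => /min; lia.
Qed.

End Exits.

(** Each column met by [V] is left upwards and downwards, each row to the right and to the left. The
    exits are told apart by direction, line, and side of the chosen point. *)
Lemma boundary_rows_cols (V : {set bsite}) a b (pc : 'I_a -> site)
    (pr : 'I_b -> site) :
  (forall i, ins V (pc i)) -> (forall i, ins V (pr i)) ->
  injective (xco \o pc) -> injective (yco \o pr) ->
  (2 * a + 2 * b <= #|bdy V|)%N.
Proof.
move=> Vc Vr ic ir; pose X : finType := ('I_a * bool + 'I_b * bool)%type.
have -> : (2 * a + 2 * b)%N = #|[set: X]|.
  by rewrite cardsT card_sum !card_prod !card_ord card_bool; lia.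
pose rel (i : X) (f : bedge) := match i with
  | inl (i, s) => [/\ f.2 = false, xco (ed f).1 = xco (pc i)
                    & (yco (pc i) <= yco (ed f).1) = s]
  | inr (j, s) => [/\ f.2 = true, yco (ed f).1 = yco (pr j)
                    & (xco (pr j) <= xco (ed f).1) = s]
  end.
apply: (@leq_card_rel _ _ _ _ rel).
  move=> [[i []]|[i []]] _.
  - have [k /cross_ed[f fE fV] _] := exit_fwd (@ins_inbox V) (Vc i) false.
    exists f => //; split; [by case: fE| |]; rewrite fE /=.
      by rewrite xco_iter_stp.
    by rewrite yco_iter_stp; lia.
  - have [k /cross_ed[f fE fV]] := exit_bwd (@ins_inbox V) (Vc i) false.
    exists f => //; split; [by case: fE| |]; rewrite fE /fst.
      by rewrite xco_iter_bstp.
    by rewrite yco_iter_bstp; lia.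
  - have [k /cross_ed[f fE fV] _] := exit_fwd (@ins_inbox V) (Vr i) true.
    exists f => //; split; [by case: fE| |]; rewrite fE /=.
      by rewrite yco_iter_stp.
    by rewrite xco_iter_stp; lia.
  - have [k /cross_ed[f fE fV]] := exit_bwd (@ins_inbox V) (Vr i) true.
    exists f => //; split; [by case: fE| |]; rewrite fE /fst.
      by rewrite yco_iter_bstp.
    by rewrite xco_iter_bstp; lia.
move=> [[i s]|[i s]] [[j t]|[j t]] f _ _ /= [h1 h2 h3] [h4 h5 h6].
- have ij : i = j by apply: ic; rewrite /= -h2 -h5.
  by rewrite ij in h3 *; rewrite -h3 -h6.
- by rewrite h1 in h4.
- by rewrite h1 in h4.
- have ij : i = j by apply: ir; rewrite /= -h2 -h5.
  by rewrite ij in h3 *; rewrite -h3 -h6.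
Qed.

(** Two distinct sites occupy two rows or two columns, whence 2 * 1 + 2 * 2. *)
Lemma boundary_ge6 V x y : ins V x -> ins V y -> x != y -> (6 <= #|bdy V|)%N.
Proof.
move=> Vx Vy xy; pose p (i : 'I_2) := if val i == 0%N then x else y.
pose q (i : 'I_1) := x.
have Vp i : ins V (p i) by rewrite /p; case: ifP.
have inj (f : site -> int) : f x != f y -> injective (f \o p).
  move=> /eqP fxy [[|[|//]] hi] [[|[|//]] hj] //=; rewrite /p /= => fE;
    by [apply/val_inj|case: fxy].
have q_inj (f : site -> int) : injective (f \o q) by move=> i j _; rewrite !ord1.
have [cxy|/inj ic] := eqVneq (xco x) (xco y).
  have rxy : yco x != yco y.
    by apply: contra xy => /eqP rxy; apply/eqP/site_eq.
  exact: (@boundary_rows_cols V 1 2 q p (fun=> Vx) Vp (q_inj _) (inj _ rxy)).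
exact: (@boundary_rows_cols V 2 1 p q Vp (fun=> Vx) ic (q_inj _)).
Qed.

(** Three distinct sites occupy either two rows and two columns, or three parallel lines and one
    transversal. *)
Lemma boundary_ge8 V x y z : ins V x -> ins V y -> ins V z ->
  x != y -> x != z -> y != z -> (8 <= #|bdy V|)%N.
Proof.
move=> Vx Vy Vz xy xz yz.
have ne (u v : site) : u != v -> xco u = xco v -> yco u = yco v -> False.
  by move=> /eqP uv h1 h2; apply/uv/site_eq.
have two (f : site -> int) u v : f u != f v ->
    injective (f \o (fun i : 'I_2 => if val i == 0%N then u else v)).
  move=> /eqP fxy [[|[|//]] hi] [[|[|//]] hj] //=; rewrite /= => fE;
    by [apply/val_inj|case: fxy].
have three (f : site -> int) : f x != f y -> f x != f z -> f y != f z ->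
    injective (f \o (fun i : 'I_3 => if val i == 0%N then x else
                       if val i == 1%N then y else z)).
  move=> /eqP h1 /eqP h2 /eqP h3 [[|[|[|//]]] hi] [[|[|[|//]]] hj] //=;
    rewrite /= => fE; by [apply/val_inj|exfalso; auto].
have one (f : site -> int) : injective (f \o (fun i : 'I_1 => x)).
  by move=> i j _; rewrite !ord1.
have case2 u v u' v' : ins V u -> ins V v -> ins V u' -> ins V v' ->
    xco u != xco v -> yco u' != yco v' -> (8 <= #|bdy V|)%N.
  move=> Vu Vv Vu' Vv' /two ic /two ir.
  by apply: (boundary_rows_cols _ _ ic ir) => i; case: ifP.
have [c1|c1] := eqVneq (xco x) (xco y); have [r1|r1] := eqVneq (yco x) (yco y).
- by have := ne _ _ xy c1 r1.
- have [c2|c2] := eqVneq (xco x) (xco z); last exact: case2 c2 r1.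
  have r2 : yco x != yco z by apply/eqP => /(ne _ _ xz c2).
  have r3 : yco y != yco z by apply/eqP => r3; apply: (ne _ _ yz) => //; rewrite -c1.
  apply: (boundary_rows_cols _ _ (one xco) (three yco r1 r2 r3)) => // i.
  by do 2 case: ifP => //.
- have [r2|r2] := eqVneq (yco x) (yco z); last exact: case2 c1 r2.
  have c2 : xco x != xco z by apply/eqP => c2; exact: (ne _ _ xz c2 r2).
  have c3 : xco y != xco z by apply/eqP => c3; apply: (ne _ _ yz) => //; rewrite -r1.
  apply: (boundary_rows_cols _ _ (three xco c1 c2 c3) (one yco)) => // i.
  by do 2 case: ifP => //.
- exact: case2 c1 r1.
Qed.

(** A site is determined by its abscissa and the edge through which its row first leaves [V] to the
    right. This linear comparison, instead of the quadratic isoperimetric one, is what the choice of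
    level is tuned to. *)
Lemma card_le_boundary (V : {set bsite}) : (#|V| <= r.*2.+1 * #|bdy V|)%N.
Proof.
have -> : (r.*2.+1 * #|bdy V|)%N =
    #|finset.setX [set: 'I_(r.*2.+1)] (bdy V)|.
  by rewrite cardsX cardsT card_ord.
pose rel (y : bsite) (p : 'I_(r.*2.+1) * bedge) :=
  [/\ p.2.2 = true, yco (ed p.2).1 = yco (val y)
    & (p.1 : nat)%:Z = xco (val y) + r%:Z].
apply: (@leq_card_rel _ _ _ _ rel).
  move=> y yV; have Vy : ins V (val y) by rewrite insE.
  have [k /cross_ed[f fE fV] _] := exit_fwd (@ins_inbox V) Vy true.
  have hr := ins_inbox Vy; rewrite /inbox in hr.
  have hi : (absz (xco (val y) + r%:Z)%R < r.*2.+1)%N by lia.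
  exists (Ordinal hi, f); first by rewrite finset.in_setX finset.in_setT fV.
  split; first by case: fE.
    by rewrite -[LHS]/(yco (ed f).1) fE yco_iter_stp.
  by move: hr => /=; lia.
move=> y y' [i f] _ _ [_ h1 h2] [_ h3 h4]; apply/val_inj.
move: h1 h2 h3 h4 => /=; case: (val y) (val y') => a b [c d] /=.
by move=> -> -> <- h; congr (_, _); lia.
Qed.

Definition dconn (V : {set bsite}) : bool :=
  `[< exists2 e, cross (ins V) e &
        forall f, cross (ins V) f -> econn (cross (ins V)) e f >].

(** There are [k] choices for the first boundary edge to the right of [x], and 8^(2k) = 64^k words
    for a walk covering the boundary from there. *)
Lemma card_contours (x : site) k :
  (#|[set V : {set bsite} | [&& ins V x, dconn V & #|bdy V| == k]]|
     <= k * 64 ^ k)%N.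
Proof.
have -> : (k * 64 ^ k)%N = #|[set: 'I_k * k.*2.-tuple letter]|.
  have cl : #|{: letter}| = 8 by rewrite card_prod card_bool card_ord.
  by rewrite cardsT card_prod card_ord card_tuple cl -mul2n expnM.
pose rel (V : {set bsite}) (c : 'I_k * k.*2.-tuple letter) :=
  cross (ins V) =i visited estep (iter c.1 (stp^~ true) x, true) c.2.
apply: (@leq_card_rel _ _ _ _ rel).
  move=> V; rewrite inE => /and3P[Vx /asboolP[e0 Ve0 e0c] /eqP kE].
  have [i Vi Vj] := exit_fwd (@ins_inbox V) Vx true.
  (* The sites from [x] to the exit fill [i + 1] columns, each of which contributes two boundary
     edges. *)
  have ik : (i < k)%N.
    rewrite -kE; have := @boundary_rows_cols V i.+1 0
      (fun j => iter j (stp^~ true) x) (fun=> x).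
    suff h : injective (xco \o (fun j : 'I_i.+1 => iter j (stp^~ true) x)).
      move=> /(_ (fun j => Vj j (leq_ord j)) (fun=> Vx) h) /(_ _) H.
      have : (2 * i.+1 + 2 * 0 <= #|bdy V|)%N by apply: H => -[].
      lia.
    by move=> u v /=; rewrite !xco_iter_stp => huv; apply/val_inj => /=; lia.
  set e : edge := (iter i (stp^~ true) x, true) in Vi.
  pose s := map ed (enum (bdy V)).
  have sE f : (f \in s) = cross (ins V) f.
    apply/mapP/idP => [[f' ]|/cross_ed[f' <- fV]].
      by rewrite mem_enum inE => Vf ->.
    by exists f'; rewrite ?mem_enum.
  have us : uniq s by rewrite map_inj_uniq ?enum_uniq//; exact: ed_inj.
  have ss : size s = k by rewrite size_map -cardE.
  have [||||w [sw wE]] := @covering_walk _ _ estep _ _ s e us.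
  - by move=> f l; apply/eadj_estep/eadjC/eadj_estep; exists l.
  - by move=> f; have /eadj_estep := eadj_refl f.
  - by rewrite sE.
  - move=> f; rewrite sE => Vf.
    have : econn (cross (ins V)) e f.
      by apply: econn_trans (e0c _ Vf); apply: econn_sym => //; exact: e0c.
    elim=> [|g h eg IH Vh gh]; first exact: rconn_refl.
    have /eadj_estep[l lE] := gh.
    by rewrite -lE; apply: rconn_step; rewrite // lE sE.
  - have sw' : size w == k.*2 by rewrite sw ss.
    exists (Ordinal ik, Tuple sw'); first by rewrite inE.
    by move=> f; rewrite -[LHS]/(cross (ins V) f) -sE -wE.
move=> V W c _ _ VE WE; apply: cross_ins_inj => f.
by rewrite -[LHS]/(f \in cross (ins V)) VE -WE.
Qed.

(* A contour is read off a closed walk of length [2 |dV|] in an alphabet of 8 letters,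
   started on the ray to the right of [x]; [k 64^k <= 128^k]. *)
Lemma contour_sum (R : realType) (x : site) (z : R) k0 :
  0 <= z -> 128 * z <= 1 / 2 ->
  \sum_(V : {set bsite} | [&& ins V x, dconn V & (k0 <= #|bdy V|)%N])
     z ^+ #|bdy V| <= 2 * (128 * z) ^+ k0.
Proof.
move=> z0 z1; set q := 128 * z; have q0 : 0 <= q by rewrite mulr_ge0.
have geom N : \sum_(k < N | (k0 <= k)%N) q ^+ k
    <= 2 * q ^+ k0 - 2 * q ^+ (maxn k0 N).
  elim: N => [|N IH]; first by rewrite big_ord0 maxn0 subrr.
  rewrite big_mkcond big_ord_recr -big_mkcond /=.
  case: leqP => kN; last first.
    by rewrite addr0; apply: le_trans IH _; rewrite (maxn_idPl (ltnW kN)) (maxn_idPl kN).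
  apply: le_trans (lerD IH (lexx _)) _.
  rewrite (maxn_idPr kN) (maxn_idPr (leqW kN)) exprS.
  have qN : 0 <= q ^+ N by exact: exprn_ge0.
  have : q * q ^+ N <= 1 / 2 * q ^+ N by exact: ler_wpM2r.
  lra.
have h (V : {set bsite}) : (#|bdy V| < #|bedge|.+1)%N by rewrite ltnS max_card.
rewrite (partition_big (fun V => Ordinal (h V)) (fun k => (k0 <= k)%N)) /=; last first.
  by move=> V /and3P[].
apply: le_trans (_ : \sum_(k < #|bedge|.+1 | (k0 <= k)%N) q ^+ k <= _); last first.
  by apply: le_trans (geom _) _; rewrite gerBl mulr_ge0// exprn_ge0.
apply: ler_sum => k kk0.
rewrite (eq_bigr (fun=> z ^+ k)); last first.
  by move=> V /andP[_ /eqP <-].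
rewrite sumr_const -mulr_natl exprMn; apply: ler_wpM2r; first exact: exprn_ge0.
rewrite -natrX ler_nat.
apply: leq_trans (_ : k * 64 ^ k <= _)%N; last first.
  rewrite (_ : 128 = 2 * 64)%N// expnMn leq_mul2r expn_eq0 /=.
  by apply/ltnW/ltn_expl.
apply: leq_trans (card_contours x k).
apply/subset_leq_card/fintype.subsetP => V /andP[/and3P[h1 h2 h3] /eqP h4].
by rewrite inE h1 h2 -h4 /= eqxx.
Qed.

End Box.

Local Open Scope classical_set_scope.
Local Open Scope ring_scope.

(** * Sums of nonnegative families *)

Section TotalSum.
Variable R : realType.

Definition tsum (X : choiceType) (g : X -> R) : \bar R :=
  (\esum_(x in [set: X]) (g x)%:E)%E.

Lemma tsum_ge0 (X : choiceType) (g : X -> R) :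
  (forall x, 0 <= g x) -> (0 <= tsum g)%E.
Proof. by move=> g0; apply: esum_ge0 => x _; rewrite lee_fin. Qed.

Lemma le_tsum (X : choiceType) (g g' : X -> R) :
  (forall x, g x <= g' x) -> (tsum g <= tsum g')%E.
Proof. by move=> gg'; apply: le_esum => x _; rewrite lee_fin. Qed.

Lemma eq_tsum (X : choiceType) (g g' : X -> R) : g =1 g' -> tsum g = tsum g'.
Proof. by move=> gg'; apply: eq_esum => x _; rewrite gg'. Qed.

Lemma tsumD (X : choiceType) (g g' : X -> R) :
  (forall x, 0 <= g x) -> (forall x, 0 <= g' x) ->
  tsum (fun x => g x + g' x) = (tsum g + tsum g')%E.
Proof.
move=> g0 g0'; rewrite /tsum -esumD//; first by move=> x _; rewrite lee_fin.
by move=> x _; rewrite lee_fin.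
Qed.

Lemma tsum_sum (X I : choiceType) (s : seq I) (P : pred I) (g : I -> X -> R) :
  (forall i x, 0 <= g i x) ->
  tsum (fun x => \sum_(i <- s | P i) g i x) = (\sum_(i <- s | P i) tsum (g i))%E.
Proof.
move=> g0; rewrite /tsum -esum_sum; last by move=> x i _ _; rewrite lee_fin.
by apply: eq_esum => x _; rewrite sumEFin.
Qed.

(** One inequality comes from finite partial sums; the other is the same inequality for the factor
    [c^-1]. *)
Lemma tsumZ (X : choiceType) (c : R) (g : X -> R) : 0 <= c ->
  (forall x, 0 <= g x) -> tsum (fun x => c * g x) = (c%:E * tsum g)%E.
Proof.
move=> c0 g0.
have le k f : 0 <= k -> (forall x, 0 <= f x) ->
    (tsum (fun x : X => k * f x)%R <= k%:E * tsum f)%E.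
  move=> k0 f0; apply: ge_ereal_sup => _ [Y [finY _] <-].
  rewrite (eq_fsbigr (fun x => k%:E * (f x)%:E)%E) => [|x _]; last by rewrite EFinM.
  rewrite -ge0_mule_fsumr; last by move=> x; rewrite lee_fin.
  apply: lee_wpmul2l; first by rewrite lee_fin.
  by apply: ereal_sup_ubound; exists Y.
apply/eqP; rewrite eq_le le//=.
have [->|c_neq0] := eqVneq c 0.
  by rewrite mul0e; apply: tsum_ge0 => x; rewrite mul0r.
have cgt0 : 0 < c by rewrite lt_def c_neq0.
have -> : tsum g = tsum (fun x => c^-1 * (c * g x)).
  by apply: eq_tsum => x; rewrite mulKf.
apply: le_trans (_ : c%:E * (c^-1%:E * tsum (fun x => c * g x)%R) <= _)%E.
  apply: lee_wpmul2l; first by rewrite lee_fin.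
  by apply: le => [|x]; rewrite ?invr_ge0 ?mulr_ge0.
by rewrite muleA -EFinM divff// mul1e.
Qed.

Lemma tsum_mkcond (X : choiceType) (A : set X) (g : X -> R) :
  (\esum_(x in A) (g x)%:E)%E = tsum (fun x => g x *+ (x \in A)).
Proof.
by rewrite esum_mkcond; apply: eq_esum => x _; case: ifP => _; rewrite ?mulr1n ?mulr0n.
Qed.

Lemma le_tsum_inj (X Y : choiceType) (A : set X) (f : X -> Y) (g : X -> R)
    (g' : Y -> R) :
  {in A &, injective f} -> (forall y, 0 <= g' y) ->
  (forall x, A x -> g x <= g' (f x)) -> (forall x, ~ A x -> g x <= 0) ->
  (tsum g <= tsum g')%E.
Proof.
move=> finj g0' gA gnA.
apply: le_trans (_ : (\esum_(x in A) (g' (f x))%:E <= _)%E).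
  rewrite [leRHS]esum_mkcond; apply: le_esum => x _.
  by case: ifPn => [/set_mem/gA|]; rewrite ?lee_fin// notin_setE => /gnA.
rewrite -(esum_image A f (fun y => (g' y)%:E))%E//.
rewrite esum_mkcond; apply: le_esum => y _.
by case: ifP => _ //; rewrite lee_fin.
Qed.

(** Freezing the coordinates outside [l] at [t0] leaves a single function when [l] is empty, and
    turns adding one coordinate into a bijection with a product. *)
Lemma tsum_prod_on (I : finType) (T : choiceType) (t0 : T) (g : I -> T -> R)
    (s : I -> R) (l : seq I) :
  (forall i t, 0 <= g i t) -> (forall i, tsum (g i) = (s i)%:E) -> uniq l ->
  (\esum_(f in [set f : {ffun I -> T} | forall i, i \notin l -> f i = t0])
     (\prod_(i <- l) g i (f i))%:E)%E = (\prod_(i <- l) s i)%:E.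
Proof.
move=> g0 gs; elim: l => [|i l IH].
  move=> _; rewrite [X in esum X _](_ : _ = [set [ffun=> t0]]).
    by rewrite esum_set1 ?big_nil.
  apply/seteqP; split=> f /=; last by move=> -> j _; rewrite ffunE.
  by move=> h; apply/ffunP => j; rewrite h// ffunE.
move=> /= /andP[il ul].
pose S := [set f : {ffun I -> T} | forall j, j \notin l -> f j = t0].
pose upd (p : T * {ffun I -> T}) : {ffun I -> T} :=
  [ffun j => if j == i then p.1 else p.2 j].
have bij : set_bij (setT `*`` (fun=> S))
    [set f : {ffun I -> T} | forall j, j \notin i :: l -> f j = t0] upd.
  split.
  - move=> [t f] [_ /= Sf] j; rewrite inE negb_or => /andP[ji jl].
    by rewrite ffunE (negbTE ji) Sf.
  - move=> [t f] [t' f'] /set_mem[_ /= Sf] /set_mem[_ /= Sf'] /ffunP E.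
    have := E i; rewrite !ffunE eqxx /= => ->; congr (_, _).
    apply/ffunP => j; have [->|ji] := eqVneq j i; first by rewrite Sf ?Sf'.
    by have := E j; rewrite !ffunE (negbTE ji).
  - move=> f /= Sf; exists (f i, [ffun j => if j == i then t0 else f j]).
      split=> //= j jl; rewrite ffunE; case: eqP => // /eqP ji.
      by rewrite Sf// inE negb_or ji.
    by apply/ffunP => j; rewrite !ffunE /=; case: eqP => [->|_].
rewrite (reindex_esum _ _ _ _ bij) /=.
have E k : (setT `*`` (fun=> S)) k ->
    ((\prod_(j <- i :: l) g j (upd k j))%:E =
     (g i k.1 * \prod_(j <- l) g j (k.2 j))%R%:E)%E.
  move=> _; rewrite big_cons ffunE eqxx; congr (_ * _)%:E.
  rewrite big_seq [RHS]big_seq; apply: eq_bigr => j jl; rewrite ffunE.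
  by case: eqP il => // <-; rewrite jl.
rewrite (eq_esum E) -(esum_esum (I := setT) (J := fun=> S)
  (a := fun t f => (g i t * \prod_(j <- l) g j (f j))%:E)); last first.
  by move=> t f _ _; rewrite lee_fin mulr_ge0// prodr_ge0.
have E' t : (\esum_(f in S) (g i t * \prod_(j <- l) g j (f j))%:E =
     (g i t * \prod_(j <- l) s j)%:E)%E.
  rewrite tsum_mkcond EFinM -(IH ul) tsum_mkcond -tsumZ//.
    by apply: eq_tsum => f; rewrite mulrnAr.
  by move=> f; rewrite mulrn_wge0// prodr_ge0.
rewrite (eq_esum (fun t _ => E' t)) big_cons EFinM -gs muleC -tsumZ//.
  by apply: eq_esum => t _; rewrite mulrC.
apply: prodr_ge0 => j _; rewrite -lee_fin -gs; exact: tsum_ge0.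
Qed.

Lemma tsum_prod (I : finType) (T : choiceType) (t0 : T) (g : I -> T -> R)
    (s : I -> R) :
  (forall i t, 0 <= g i t) -> (forall i, tsum (g i) = (s i)%:E) ->
  tsum (fun f : {ffun I -> T} => \prod_i g i (f i)) = (\prod_i s i)%:E.
Proof.
move=> g0 gs; rewrite -big_enum.
rewrite -(tsum_prod_on t0 g0 gs (enum_uniq I)) tsum_mkcond; apply: eq_tsum => f.
by rewrite big_enum mem_set//= => i; rewrite mem_enum.
Qed.

Lemma tsum_geometric (q : R) : 0 <= q < 1 ->
  tsum (fun k : nat => q ^+ k) = ((1 - q)^-1)%:E.
Proof.
move=> /andP[q0 q1]; rewrite /tsum -nneseries_esumT; last first.
  by move=> k; rewrite lee_fin exprn_ge0.
apply/cvg_lim => //.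
have := @cvg_geometric_series R 1 q; rewrite ger0_norm// mul1r => /(_ q1) h.
rewrite (_ : (fun n => _) = EFin \o series (geometric 1 q)).
  by apply: cvg_EFin => //; exact: nearW.
apply/funext => n /=; rewrite /series /= -sumEFin.
by apply: eq_bigr => k _; rewrite mul1r.
Qed.

End TotalSum.

(** * The model with negative heights *)

Definition pos (a : int) : nat := if a is Posz k then k else 0%N.
Definition neg (a : int) : nat := if a is Negz k then k.+1 else 0%N.

Lemma posnegE a : a = (pos a)%:Z - (neg a)%:Z.
Proof. by case: a => k /=; lia. Qed.

Lemma pos_neg0 a : pos a = 0%N \/ neg a = 0%N.
Proof. by case: a => k; [right|left]. Qed.

(* Equal to [|a - b| + 2 min(a^-, b^-)].  Below an isolated site at height zero each
   unit of depth costs 4, whence the weight [sum_k e^{-4 beta k} = e^{lambda_w}]. *)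
Definition bcost (a b : int) : nat :=
  (absz ((pos a)%:Z - (pos b)%:Z)%R + neg a + neg b)%N.

Ltac bcost_tac := rewrite /bcost;
  repeat match goal with
  | |- context [pos ?a] => lazymatch goal with
     | H : a = (pos a)%:Z - (neg a)%:Z |- _ => fail
     | _ => let E := fresh in let P := fresh in
            have E := posnegE a; have P := pos_neg0 a end
  end; lia.

(** The whole interaction with the floor: a rigid shift by one changes the cost of a bond only if
    both of its ends are negative at the lower position. *)
Lemma bcost_up_up a b : (bcost (a + 1) (b + 1) + 2 * ((a < 0)%R && (b < 0)%R) = bcost a b)%N.
Proof. by bcost_tac. Qed.

Lemma bcost_up a b : a < b -> (bcost (a + 1) b + 1 = bcost a b)%N.
Proof. by bcost_tac. Qed.

Lemma bcost_down a b : 1 <= a -> b < a -> (bcost (a - 1) b + 1 = bcost a b)%N.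
Proof. by bcost_tac. Qed.

Lemma bcost_up_le a b : (bcost (a + 1) b <= bcost a b + 1)%N.
Proof. by bcost_tac. Qed.

Lemma bcostC a b : bcost a b = bcost b a.
Proof. by bcost_tac. Qed.

Lemma bcost_ge_dist a b : (absz (a - b)%R <= bcost a b)%N.
Proof. by bcost_tac. Qed.

Section Config.
Variable r : nat.

Definition config : choiceType := {ffun bsite r -> int}.

Definition ext (psi : config) (x : site) : int :=
  if insub x is Some y then psi y else 0.

Lemma ext_val psi y : ext psi (val y) = psi y.
Proof. by rewrite /ext valK. Qed.

Lemma ext_out psi x : ~~ inbox r x -> ext psi x = 0.
Proof. by rewrite /ext -mem_box; case: insubP => // y ->. Qed.

Definition src (e : bedge r) : site := (ed e).1.
Definition tgt (e : bedge r) : site := stp (ed e).1 (ed e).2.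

Definition energy (psi : config) : nat :=
  (\sum_(e : bedge r) bcost (ext psi (src e)) (ext psi (tgt e)))%N.

Definition wt (R : realType) (b : R) (psi : config) : R :=
  expR (- b * (energy psi)%:R).

Lemma wt_ge0 (R : realType) (b : R) psi : 0 <= wt b psi.
Proof. exact: expR_ge0. Qed.

Definition partfun (R : realType) (b : R) : \bar R := tsum (wt b).

End Config.

Arguments box : simpl never.

Lemma uniq_zrange r : uniq (zrange r).
Proof.
by rewrite map_inj_uniq ?iota_uniq// => i j; lia.
Qed.

Lemma uniq_box r : uniq (box r).
Proof.
by rewrite allpairs_uniq ?uniq_zrange// => -[a b] [c d] _ _ /= [-> ->].
Qed.

Lemma card_bsite r : #|bsite r| = (r.*2.+1 ^ 2)%N.
Proof.
rewrite card_seq_sub ?uniq_box// size_allpairs size_map size_iota.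
by rewrite -mulnn.
Qed.

Lemma sum_bsite (V : nmodType) r (F : site -> V) :
  \sum_(x <- box r) F x = \sum_(y : bsite r) F (val y).
Proof.
rewrite (perm_big [seq val y | y : bsite r]); last first.
  apply: uniq_perm; first exact: uniq_box.
    by rewrite (map_inj_uniq val_inj) enum_uniq.
  move=> x; apply/idP/mapP => [xr|[y _ ->]]; last exact: valP.
  by exists (SeqSub xr); rewrite ?mem_enum.
by rewrite big_map big_enum.
Qed.

Lemma sum_bedge (V : nmodType) r (F : site -> bool -> V) :
  \sum_(e : bedge r) F (src e) e.2 =
  \sum_(x <- box r.+1) (F x true + F x false).
Proof.
rewrite sum_bsite -(pair_bigA _ (fun x b => F (val x) b)) /=.
by apply: eq_bigr => x _; rewrite big_bool.
Qed.

Lemma nn_lexE (x y : site) :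
  (nn x y && ((x.1 < y.1) || (x.1 == y.1) && (x.2 < y.2))) =
  (y == stp x true) || (y == stp x false).
Proof.
case: x y => a b [c d]; rewrite /nn /stp /= !xpair_eqE; lia.
Qed.

Lemma inbox_stp r x b : inbox r x -> inbox r.+1 (stp x b).
Proof. by rewrite /inbox !stpE; case: b; lia. Qed.

Lemma inboxS r x : inbox r x -> inbox r.+1 x.
Proof. by rewrite /inbox; lia. Qed.

Lemma inbox_stp_inv r x b : inbox r (stp x b) -> inbox r.+1 x.
Proof. by rewrite /inbox !stpE; case: b; lia. Qed.

(** The type [bedge] also contains bonds of the larger box that miss [Lambda n]; the hypothesis
    makes them contribute nothing. *)
Lemma sum_bonds (n : nat) (F : site -> site -> nat) :
  (forall x y, ~~ inbox n./2 x -> ~~ inbox n./2 y -> F x y = 0%N) ->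
  (\sum_(e <- bonds n) F e.1 e.2)%N =
  (\sum_(e : bedge n./2) F (src e) (tgt e))%N.
Proof.
move=> F0; set r := n./2 in F0 *.
rewrite /bonds big_filter big_mkcond big_allpairs /=.
rewrite (sum_bedge r (fun x b => F x (stp x b))) big_seq [RHS]big_seq.
apply: eq_bigr => x; rewrite mem_box => xr.
under eq_bigr => y _ do rewrite andbA nn_lexE !mem_box -/r.
have one b : (\sum_(y <- box r.+1) (if y == stp x b then F x y else 0))%N
   = F x (stp x b).
  have [yr|yr] := boolP (stp x b \in box r.+1).
    rewrite (bigD1_seq _ yr (uniq_box _)) /= eqxx big1 ?addn0// => y.
    by move=> /negbTE ->.
  rewrite F0; last 2 first.
  - by apply: contra yr => /(@inbox_stp _ _ b); rewrite mem_box.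
  - by apply: contra yr => /inboxS; rewrite mem_box.
  rewrite big1_seq// => y /andP[_ ys].
  by case: eqP => // yE; rewrite -yE ys in yr.
rewrite -[in RHS]one -[F x (stp x false)]one -big_split /=.
apply: eq_bigr => y _.
have ne : stp x true != stp x false.
  by rewrite /stp xpair_eqE; case: x {xr one} => a b /=; lia.
have [tr|] := boolP (inbox r x || inbox r y); last first.
  rewrite negb_or => /andP[xr' yr']; rewrite andbF F0//.
  by case: ifP; case: ifP.
rewrite andbT; case: eqP => [->|_] /=; last by case: ifP.
by rewrite (negbTE ne) addr0.
Qed.

Section Link.
Variable r : nat.

Definition posfun (psi : config r) : {ffun bsite r -> nat} :=
  [ffun y => pos (psi y)].

Lemma sum_shift (g : site -> nat) b :
  (forall x, ~~ inbox r x -> g x = 0%N) ->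
  (\sum_(x <- box r.+1) g (stp x b) = \sum_(x <- box r) g x)%N.
Proof.
move=> g0; move: (box r.+1) (mem_box r.+1) (uniq_box r.+1) => s sE us.
rewrite -(big_map (stp^~ b) xpredT g).
rewrite [LHS](bigID (inbox r)) /= [X in (_ + X)%N]big1 ?addn0; last first.
  by move=> x; exact: g0.
rewrite -big_filter; apply: perm_big; apply: uniq_perm.
- by apply: filter_uniq; rewrite (map_inj_uniq (can_inj (bstpK b))).
- exact: uniq_box.
- move=> x; rewrite mem_filter mem_box; case xr : (inbox r x) => //=.
  apply/mapP; exists (bstp x b); last exact: esym (stpK b x).
  by rewrite sE; apply: (@inbox_stp_inv _ _ b); rewrite (stpK b x).
Qed.

Lemma sum_endpoints (g : site -> nat) :
  (forall x, ~~ inbox r x -> g x = 0%N) ->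
  (\sum_(e : bedge r) (g (src e) + g (tgt e)) =
   4 * \sum_(y : bsite r) g (val y))%N.
Proof.
move=> g0; rewrite (sum_bedge r (fun x b => g x + g (stp x b))%N).
have h0 : (\sum_(x <- box r.+1) g x = \sum_(x <- box r) g x)%N.
  rewrite [LHS](bigID (inbox r)) /= [X in (_ + X)%N]big1 ?addn0; last first.
    by move=> x; exact: g0.
  rewrite -big_filter; apply: perm_big; apply: uniq_perm.
  - by apply: filter_uniq; exact: uniq_box.
  - exact: uniq_box.
  - move=> x; rewrite mem_filter !mem_box; case xr : (inbox r x) => //=.
    exact: inboxS.
pose S := (\sum_(y : bsite r) g (val y))%N; rewrite -/S.
rewrite !big_split /= !sum_shift// h0 sum_bsite.
by rewrite -[LHS]/(S + S + (S + S))%N; lia.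
Qed.

(** Negative parts enter [bcost] additively and every site of the box lies on four bonds. Given the
    positive part, the depths are therefore independent, each unit costing 4. *)
Lemma energy_split (psi : config r) :
  energy psi = (\sum_(e : bedge r)
     absz ((pos (ext psi (src e)))%:Z - (pos (ext psi (tgt e)))%:Z)%R
   + 4 * \sum_(y : bsite r) neg (psi y))%N.
Proof.
rewrite /energy /bcost.
under eq_bigr do rewrite -addnA.
rewrite big_split /=; congr (_ + _)%N.
rewrite (@sum_endpoints (fun x => neg (ext psi x))); last first.
  by move=> x xr; rewrite ext_out.
by congr (_ * _)%N; apply: eq_bigr => y _; rewrite ext_val.
Qed.



Lemma tsum_int_geometric (R : realType) (q : R) : 0 < q < 1 ->
  exists2 s : R, tsum (fun t : int => q ^+ absz t) = s%:E & s <= 2 / (1 - q).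
Proof.
move=> /andP[q0 q1].
have q01 : 0 <= q < 1 by rewrite ltW.
have ge0 (X : Type) (f : X -> nat) x : 0 <= q ^+ f x by rewrite exprn_ge0// ltW.
have le : (tsum (fun t : int => q ^+ absz t)%R <= (2 / (1 - q))%:E)%E.
  rewrite (_ : 2 / (1 - q) = (1 - q)^-1 + (1 - q)^-1); last by field; lra.
  rewrite EFinD -tsum_geometric//.
  apply: (@le_trans _ _ (tsum (fun t : int => q ^+ absz t *+ (0 <= t)%R
     + q ^+ absz t *+ (t <= 0)%R))).
    apply: le_tsum => t; case: (lerP 0 t) => h /=; first by rewrite lerDl mulrn_wge0.
    by rewrite mulr0n add0r (ltW h).
  rewrite tsumD; [|by move=> t; rewrite mulrn_wge0..].
  apply: leeD.
    apply: (@le_tsum_inj _ _ _ [set t : int | 0 <= t] absz) => //.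
    - by move=> s t /set_mem /= s0 /set_mem /= t0; lia.
    - by move=> k; exact: (ge0 nat id).
    - by move=> t /= ->.
    - by move=> t /= /negP/negbTE ->.
  apply: (@le_tsum_inj _ _ _ [set t : int | t <= 0] absz) => //.
  - by move=> s t /set_mem /= s0 /set_mem /= t0; lia.
  - by move=> k; exact: (ge0 nat id).
  - by move=> t /= ->.
  - by move=> t /= /negP/negbTE ->.
have ge : (0 <= tsum (fun t : int => q ^+ absz t)%R)%E by exact: tsum_ge0.
case: tsum le ge => // s; rewrite lee_fin => le _; by exists s.
Qed.

(** Vertical bonds are dropped. The horizontal increments determine the surface, which is 0 to the
    left of the box, and each is summed separately with total at most 4. Besides finiteness, this
    bound at b/2 controls the energy. *)
Lemma partfun_le (R : realType) (b : R) : 0 <= b -> expR (- b) <= 1 / 2 ->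
  (partfun r b <= (4 ^+ (r.*2.+1 ^ 2))%:E)%E.
Proof.
move=> b0 bq; have q01 : 0 < expR (- b) < 1 by rewrite expR_gt0; lra.
have [s sE s4] := tsum_int_geometric q01.
have {}s4 : s <= 4.
  apply: le_trans s4 _; rewrite ler_pdivrMr; lra.
have s0 : 0 <= s by rewrite -lee_fin -sE; apply: tsum_ge0 => t; rewrite exprn_ge0// expR_ge0.
pose grad (psi : config r) : {ffun bsite r -> int} :=
  [ffun y => psi y - ext psi (bstp (val y) true)].
apply: le_trans (_ : (tsum (fun f : {ffun bsite r -> int} =>
    \prod_y expR (- b) ^+ absz (f y))%R <= _))%E; last first.
  rewrite (@tsum_prod R (bsite r) int 0%R (fun _ t => expR (- b) ^+ absz t)
    (fun=> s)); [|by move=> *; rewrite exprn_ge0// expR_ge0|by []].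
  by rewrite prodr_const lee_fin card_bsite; apply: lerXn2r; rewrite ?nnegrE.
rewrite /partfun; apply: (@le_tsum_inj _ _ _ setT grad (wt b)); last by move=> psi /(_ I).
- move=> psi psi' _ _ /ffunP E; apply/ffunP => y.
  suff h (k : nat) z : xco (val z) + r%:Z = k%:Z -> psi z = psi' z.
    have := valP y; rewrite mem_box /inbox => yr.
    apply: (h (absz (xco (val y) + r%:Z)%R)); move: yr => /=; lia.
  elim: k z => [|k IH] z zk; have := E z; rewrite !ffunE.
    rewrite !ext_out ?subr0//; rewrite /inbox /bstp; move: zk => /=; lia.
  have [zr|zr] := boolP (inbox r (bstp (val z) true)); last first.
    by rewrite !ext_out ?subr0.
  have [w wz] := inbox_val zr; rewrite -wz !ext_val (IH w); first by lia.
  by rewrite wz /bstp /=; move: zk => /=; lia.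
- by move=> f; rewrite prodr_ge0// => y _; rewrite exprn_ge0// expR_ge0.
move=> psi _; rewrite /wt.
under eq_bigr do rewrite -expRM_natl mulrC.
rewrite -expR_sum ler_expR -mulr_sumr ler_wnM2l ?oppr_le0//.
rewrite -natr_sum ler_nat /energy.
rewrite (sum_bedge r (fun x b => bcost (ext psi x) (ext psi (stp x b)))).
pose g z := if inbox r z then absz (ext psi z - ext psi (bstp z true))%R else 0%N.
apply: leq_trans (_ : \sum_(x <- box r.+1) g (stp x true) <= _)%N; last first.
  apply: leq_sum => x _; apply: leq_trans (leq_addr _ _).
  rewrite /g; case: ifP => // _; rewrite (bstpK true x) bcostC.
  exact: bcost_ge_dist.
rewrite sum_shift; last by move=> x /negbTE xr; rewrite /g xr.
rewrite (sum_bsite r g); apply/eq_leq/eq_bigr => y _.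
by rewrite /g -mem_box (valP y) ffunE ext_val.
Qed.

End Link.

Section PinnedLink.
Variables (R : realType) (n : nat) (b : R).
Hypothesis b0 : 0 < b.

Let r := n./2.
Let q := expR (- (4 * b)).

Lemma q_lt1 : 0 < q < 1.
Proof. by rewrite /q expR_gt0 expR_lt1 /= oppr_lt0 mulr_gt0. Qed.

Lemma extend0_posfun (psi : config r) x :
  @extend0 n (posfun psi) x = pos (ext psi x).
Proof. by rewrite /extend0 /ext; case: insubP => // y; rewrite ffunE. Qed.

Lemma sos_energy_posfun (psi : config r) :
  energy psi = (@sos_energy n (posfun psi) + 4 * \sum_y neg (psi y))%N.
Proof.
rewrite energy_split /sos_energy
  (@sum_bonds n (fun x y => absz ((extend0 (posfun psi : height n) x)%:Z
                             - (extend0 (posfun psi : height n) y)%:Z)%R)).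
  by congr (_ + _)%N; apply: eq_bigr => e _; rewrite !extend0_posfun.
by move=> x y xr yr; rewrite !extend0_posfun !ext_out.
Qed.

Lemma tsum_neg_fiber (k : nat) :
  tsum (fun t : int => q ^+ neg t *+ (pos t == k)) =
  (if k == 0%N then (1 - q)^-1 else 1)%:E.
Proof.
have /andP[q0 q1] := q_lt1.
have E (A : set int) (f : nat -> int) (J : set nat) :
    set_bij J A f -> (forall t, (t \in A) = (pos t == k)) ->
    tsum (fun t : int => q ^+ neg t *+ (pos t == k)) =
    (\esum_(i in J) (q ^+ neg (f i))%:E)%E.
  move=> bij AE; rewrite -(reindex_esum _ _ _ (fun t => (q ^+ neg t)%:E) bij).
  by rewrite tsum_mkcond; apply: eq_tsum => t; rewrite AE.
case: eqP => [k0|/eqP k0].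
  rewrite (E [set t : int | t <= 0] (fun i => - i%:Z) setT).
  - rewrite -tsum_geometric ?ltW//; apply: eq_esum => i _.
    by congr (_ ^+ _)%:E; case: i => // i; rewrite -NegzE.
  - split=> //=.
    + by move=> i _ /=; lia.
    + by move=> i j _ _ /eqP; rewrite eqr_opp => /eqP [].
    + by move=> t /= t0; exists (absz t) => //; lia.
  - move=> t; rewrite k0; apply/idP/idP => [/set_mem/=|h].
      by case: t => // i; rewrite /pos; lia.
    by apply/mem_set => /=; move: h; case: t => // i /=; lia.
rewrite (E [set k%:Z] (fun i => k%:Z) [set 0%N]).
- by rewrite esum_set1/= ?expr0// lee_fin.
- split=> //=; first by move=> i j /set_mem -> /set_mem ->.
  by move=> t ->; exists 0%N.
- move=> t; apply/idP/idP => [/set_mem -> //=|h]; apply/mem_set.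
  by move: h k0; case: t => i /= /eqP <-.
Qed.

Lemma expR_lambda_w : expR (lambda_w b) = (1 - q)^-1.
Proof.
by rewrite /lambda_w expRN lnK// posrE subr_gt0; case/andP: q_lt1.
Qed.

(** A positive height has one preimage under [pos], while height 0 has one for every depth; the
    geometric series over depths is e^(lambda_w), one factor for each zero. *)
Lemma fiber_mass (phi : height n) :
  tsum (fun psi : config r => wt b psi *+ (posfun psi == phi)) =
  (sos_weight b (lambda_w b) phi)%:E.
Proof.
have /andP[q0 q1] := q_lt1.
rewrite /sos_weight expRD [_ * (zeros phi)%:R]mulrC expRM_natl expR_lambda_w.
have -> : (1 - q)^-1 ^+ zeros phi =
    \prod_(y : bsite r) (if phi y == 0%N then (1 - q)^-1 else 1).
  by rewrite -big_mkcond prodr_const.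
pose g (y : bsite r) (t : int) : R := q ^+ neg t *+ (pos t == phi y).
have g0 y t : 0 <= g y t by rewrite mulrn_wge0// exprn_ge0// ltW.
rewrite EFinM -(@tsum_prod R (bsite r) int 0%R g _ g0); last first.
  by move=> y; exact: tsum_neg_fiber.
rewrite -tsumZ ?expR_ge0//; last by move=> f; rewrite prodr_ge0.
apply: eq_tsum => psi; have [E|ne] := eqVneq (posfun psi) phi.
  rewrite mulr1n /wt sos_energy_posfun E natrD mulrDr expRD; congr (_ * _).
  rewrite natrM natr_sum !mulr_sumr expR_sum; apply: eq_bigr => y _.
  rewrite /g -E ffunE eqxx mulr1n /q -expRM_natl; congr (expR _); ring.
have [y ny] : exists y, pos (psi y) != phi y.
  apply/existsP; apply: contraNT ne => /existsPn h; apply/eqP/ffunP => y.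
  by rewrite ffunE; apply/eqP/negPn/h.
by rewrite mulr0n (bigD1 y)//= /g (negbTE ny) mulr0n mul0r mulr0.
Qed.

Lemma sos_massE (A : set (height n)) :
  sos_mass b (lambda_w b) A =
  tsum (fun psi : config r => wt b psi *+ ((posfun psi : height n) \in A)).
Proof.
pose J (phi : height n) := [set psi : config r | posfun psi = phi].
have bij : set_bij [set psi : config r | A (posfun psi)] (A `*`` J)
    (fun psi => (posfun psi : height n, psi)).
  split; first by move=> psi /= Apsi.
  - by move=> psi psi' _ _ [].
  - by move=> [phi psi] [/= Aphi]; rewrite /J /= => E; exists psi; rewrite ?E.
transitivity (\esum_(phi in A) \esum_(psi in J phi) (wt b psi)%:E)%E.
  apply: eq_esum => phi _; rewrite -fiber_mass tsum_mkcond.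
  by apply: eq_tsum => psi; congr (_ *+ nat_of_bool _); apply/idP/idP => [/eqP/mem_set|/set_mem/eqP].
rewrite esum_esum; last by move=> *; rewrite lee_fin wt_ge0.
rewrite (reindex_esum _ _ _ _ bij) /= tsum_mkcond; apply: eq_tsum => psi.
by congr (_ *+ nat_of_bool _); apply/idP/idP => [/set_mem/mem_set|/set_mem/mem_set].
Qed.

End PinnedLink.

(** * Peierls maps *)

Lemma contour_at r (A : pred site) x : {subset A <= inbox r} -> hull r A x ->
  exists2 e, cross (hull r A) e &
    ins (toset r (contour r A e)) x.
Proof.
move=> Ar /(contour_cover Ar)[e He ex]; exists e => //.
by rewrite ins_toset// => y /(contour_sub_hull Ar He)/(hull_inbox Ar).
Qed.

Lemma contour_setE r (A : pred site) e : {subset A <= inbox r} ->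
  cross (hull r A) e -> ins (toset r (contour r A e)) =1 contour r A e.
Proof.
move=> Ar He; apply: ins_toset => y.
by move=> /(contour_sub_hull Ar He)/(hull_inbox Ar).
Qed.

Lemma contour_dconn r (A : pred site) e : {subset A <= inbox r} ->
  cross (hull r A) e -> dconn (toset r (contour r A e)).
Proof.
move=> Ar He; apply/asboolP.
have -> : ins (toset r (contour r A e)) = contour r A e.
  by apply/funext; exact: contour_setE.
exists e; last by move=> f; exact: contour_econn.
by rewrite cross_contour//; apply/asboolP; exact: econn_refl.
Qed.

Section Shift.
Variable r : nat.
Implicit Types (psi : config r) (U V : {set bsite r}).

Definition shift_on V (k : int) psi : config r :=
  [ffun y => psi y + (if y \in V then k else 0)].

Lemma ext_shift_on V k psi x :
  ext (shift_on V k psi) x = ext psi x + (if ins V x then k else 0).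
Proof. by rewrite /ext /ins; case: insubP => [y _ _|_]; rewrite ?ffunE ?addr0. Qed.

Lemma shift_on_inj V k : injective (shift_on V k).
Proof. by move=> psi psi' /ffunP E; apply/ffunP => y; have := E y; rewrite !ffunE => /addIr. Qed.

Lemma nb_src_tgt (e : bedge r) : nb (src e) (tgt e).
Proof. by left; exists (ed e).2. Qed.

Lemma card_bdy V : #|bdy V| = (\sum_(e : bedge r) (ins V (src e) (+) ins V (tgt e)))%N.
Proof. by rewrite sum_nat_of_bool. Qed.

Lemma energy_raise V psi :
  (forall x y, nb x y -> ins V x -> ~~ ins V y -> ext psi x < ext psi y) ->
  (energy (shift_on V 1 psi) + #|bdy V| <= energy psi)%N.
Proof.
move=> h; rewrite card_bdy /energy -big_split /=; apply: leq_sum => e _.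
rewrite !ext_shift_on; have xy := nb_src_tgt e.
case s : (ins V (src e)); case t : (ins V (tgt e)) => /=; rewrite ?addr0 ?addn0//.
- by rewrite -(bcost_up_up (ext psi (src e))) leq_addr.
- by rewrite bcost_up// h ?t.
- rewrite bcostC -(bcostC (ext psi (tgt e))) bcost_up// h ?s//; exact: nbC.
Qed.

(** These are the bonds inside [U] whose two ends become negative when [U] is lowered by one. *)
Definition below U psi : nat :=
  (\sum_(e : bedge r | ins U (src e) && ins U (tgt e))
     ((ext psi (src e) <= 0)%R && (ext psi (tgt e) <= 0)%R))%N.

(** The boundary of [U] is part of a level line at height [h]; heights away from that boundary are
    free and may reach the floor. *)
Definition elevated U (h : nat) : set (config r) :=
  [set psi | forall x y, nb x y -> ins U x -> ~~ ins U y ->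
     h%:Z <= ext psi x /\ ext psi y < h%:Z].

Lemma energy_lower U h psi : (0 < h)%N -> elevated U h psi ->
  (energy (shift_on U (-1) psi) + #|bdy U| <= energy psi + 2 * below U psi)%N.
Proof.
move=> h0 Epsi; rewrite card_bdy /energy /below [X in (2 * X)%N]big_mkcond big_distrr /=.
rewrite -!big_split /=; apply: leq_sum => e _.
rewrite !ext_shift_on; have xy := nb_src_tgt e.
case s : (ins U (src e)); case t : (ins U (tgt e)) => /=; rewrite ?addr0 ?addn0//.
- rewrite -(bcost_up_up (ext psi (src e) - 1) (ext psi (tgt e) - 1)).
  rewrite !subrK; have -> a : (a - 1 < 0 :> int) = (a <= 0) by lia.
  have -> a : (a - 1 < 0 :> int) = (a <= 0) by lia.
  lia.
- have [] := Epsi _ _ xy s; first by rewrite t.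
  by move=> h1 h2; rewrite bcost_down//; lia.
- have [] := Epsi _ _ (nbC xy) t; first by rewrite s.
  by move=> h1 h2; rewrite bcostC -(bcostC (ext psi (tgt e))) bcost_down//; lia.
Qed.

End Shift.

Section Mass.
Variables (R : realType) (r : nat) (b : R).
Implicit Types (A B : set (config r)).

Definition mass A : \bar R := tsum (fun psi => wt b psi *+ (psi \in A)).

Lemma wtn_ge0 (psi : config r) (c : nat) : 0 <= wt b psi *+ c.
Proof. by rewrite mulrn_wge0// wt_ge0. Qed.

Lemma mass_ge0 A : (0 <= mass A)%E.
Proof. by apply: tsum_ge0 => psi; exact: wtn_ge0. Qed.

Lemma le_mass A B : A `<=` B -> (mass A <= mass B)%E.
Proof.
move=> AB; apply: le_tsum => psi.
case: (boolP (psi \in A)) => [/set_mem/AB/mem_set -> //|_].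
by rewrite mulr0n wtn_ge0.
Qed.

Lemma mass_setT : mass setT = partfun r b.
Proof. by apply: eq_tsum => psi; rewrite in_setT. Qed.

Lemma mass_sub_sum (I : choiceType) (s : seq I) (P : pred I) A
    (B : I -> set (config r)) :
  (forall psi, A psi -> exists2 i, i \in s & P i /\ B i psi) ->
  (mass A <= \sum_(i <- s | P i) mass (B i))%E.
Proof.
move=> AB; rewrite -tsum_sum; last by move=> *; exact: wtn_ge0.
apply: le_tsum => psi; case: (boolP (psi \in A)) => [/set_mem/AB[i si [Pi Bi]]|_].
  rewrite (big_rem i si) /= Pi mem_set// lerDl sumr_ge0// => j _.
  exact: wtn_ge0.
by rewrite sumr_ge0// => j _; exact: wtn_ge0.
Qed.

Lemma wtE (psi : config r) : wt b psi = expR (- b) ^+ energy psi.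
Proof. by rewrite /wt mulrC expRM_natl. Qed.

Hypothesis b0 : 0 <= b.

Lemma le_mass_map A B (f : config r -> config r) k :
  injective f -> (forall psi, A psi -> B (f psi) /\ (energy (f psi) + k <= energy psi)%N) ->
  (mass A <= (expR (- b) ^+ k)%:E * mass B)%E.
Proof.
move=> fi fAB; rewrite -tsumZ ?exprn_ge0 ?expR_ge0//; last by move=> *; exact: wtn_ge0.
apply: (@le_tsum_inj _ _ _ A f) => //.
- by move=> psi psi' _ _; exact: fi.
- by move=> psi; rewrite mulr_ge0 ?exprn_ge0 ?expR_ge0//; exact: wtn_ge0.
- move=> psi Apsi; have [Bf le] := fAB _ Apsi.
  rewrite !mem_set// !mulr1n !wtE -exprD addnC; apply: ler_wiXn2l; rewrite ?expR_ge0//.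
  by rewrite -expR0 ler_expR oppr_le0.
- by move=> psi nA; rewrite memNset.
Qed.

End Mass.

(** * Low dimers and trimers inside an elevated set *)

Lemma subz_succ_lt (h j : nat) : h%:Z - j.+1%:Z < h%:Z.
Proof. by lia. Qed.

Lemma subz_succD1 (h j : nat) : h%:Z - j.+1%:Z + 1 = h%:Z - j%:Z.
Proof. by lia. Qed.

Section Downward.
Variables (R : realType) (r : nat) (b : R).
Hypothesis b0 : 0 <= b.
Let z := expR (- b).
Hypothesis hz : 2 * 128 ^+ 8 * z <= 1.
Variables (U : {set bsite r}) (h : nat).
Hypothesis cU : coconn r (ins U).
Implicit Types (V : {set bsite r}) (psi : config r).

Let z0 : 0 <= z. Proof. exact: expR_ge0. Qed.

Definition low (s : seq site) (k : int) : set (config r) :=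
  [set psi | elevated U h psi /\ forall x, x \in s -> ext psi x <= k].

Lemma elevated_raise V psi : {subset ins V <= ins U} ->
  elevated U h psi -> elevated U h (shift_on V 1 psi).
Proof.
move=> VU Epsi x y xy Ux Uy; have [h1 h2] := Epsi x y xy Ux Uy.
rewrite !ext_shift_on; have /negbTE -> : ~~ ins V y by apply: contra Uy; exact: VU.
by rewrite addr0; split=> //; case: ifP; lia.
Qed.

Lemma low_raise s k V psi : {subset ins V <= ins U} ->
  low s k psi -> low s (k + 1) (shift_on V 1 psi).
Proof.
move=> VU [Epsi sk]; split; first exact: elevated_raise.
by move=> x /sk xk; rewrite ext_shift_on; case: ifP; lia.
Qed.

Lemma le_mass_raise s k V A : {subset ins V <= ins U} ->
  A `<=` low s k ->
  (forall psi, A psi -> forall x y, nb x y -> ins V x -> ~~ ins V y ->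
     ext psi x < ext psi y) ->
  (mass b A <= (z ^+ #|bdy V|)%:E * mass b (low s (k + 1)%R))%E.
Proof.
move=> VU As AV; apply: (@le_mass_map _ _ _ b0 _ _ (shift_on V 1)).
  exact: shift_on_inj.
move=> psi Apsi; split; first by apply: low_raise => //; exact: As.
by apply: energy_raise; exact: AV.
Qed.

Lemma low_inU psi x y k : (k < h%:Z) -> elevated U h psi -> ins U x ->
  ext psi x <= k -> nb x y -> ins U y.
Proof.
move=> kh Epsi Ux xk xy; apply: contraLR kh => Uy.
by have [] := Epsi _ _ xy Ux Uy; lia.
Qed.

(** The contour is that of the part of [U] at height at most [k]. Since [U] has no holes, filling
    this part stays inside [U], so raising the contour keeps [elevated]. The last clause lets a
    contour around one low site enclose its low neighbors as well. *)
Lemma low_contour psi x k : k < h%:Z -> elevated U h psi -> ins U x ->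
  ext psi x <= k ->
  exists V, [/\ dconn V, ins V x, {subset ins V <= ins U},
    forall u v, nb u v -> ins V u -> ~~ ins V v -> ext psi u < ext psi v &
    forall u v, nb u v -> ins V u -> ins U v -> ext psi v <= k -> ins V v].
Proof.
move=> kh Epsi Ux xk; pose A : pred site := fun y => ins U y && (ext psi y <= k).
have AU : {subset A <= ins U} by move=> y /andP[].
have Ar : {subset A <= inbox r} by move=> y /AU /ins_inbox.
have Hx : hull r A x by apply: sub_hull; rewrite /A Ux.
have [e He Vx] := contour_at Ar Hx.
have VE := contour_setE Ar He; set V := toset _ _ in VE Vx.
have bnd u v : nb u v -> ins V u -> ~~ ins V v -> A u /\ ~~ A v.
  move=> uv; rewrite !VE => Vu Vv.
  have [Au Hv] := contour_boundary Ar He uv Vu Vv; split=> //.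
  by apply: contra Hv; exact: sub_hull.
exists V; split=> //.
- exact: contour_dconn.
- move=> y; rewrite [_ \in _]VE => /(contour_sub_hull Ar He).
  exact: hull_min.
- move=> u v uv Vu Vv; have [/andP[Uu uk] Av] := bnd _ _ uv Vu Vv.
  have Uv := low_inU kh Epsi Uu uk uv.
  by move: Av; rewrite /A Uv /= -ltNge; exact: le_lt_trans.
- move=> u v uv Vu Uv vk; apply/negPn/negP => Vv.
  by have [_] := bnd _ _ uv Vu Vv; rewrite /A Uv vk.
Qed.

(* Raising the inside of the contour around the trimer gains its length, at least 8;
   one of the 8 factors absorbs the entropy. *)
Lemma trimer_step x y w k : nb x y -> nb x w \/ nb y w ->
  x != y -> x != w -> y != w -> ins U x -> ins U y -> ins U w -> k < h%:Z ->
  (mass b (low [:: x; y; w] k) <=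
   (z ^+ 7)%:E * mass b (low [:: x; y; w] (k + 1)%R))%E.
Proof.
move=> xy xyw nxy nxw nyw Ux Uy Uw kh; set s := [:: x; y; w].
pose P V := [&& ins V x, dconn V & (8 <= #|bdy V|)%N].
pose BV V := [set psi | low s k psi /\ {subset ins V <= ins U} /\
  forall u v, nb u v -> ins V u -> ~~ ins V v -> ext psi u < ext psi v].
apply: le_trans (_ : (\sum_(V : {set bsite r} | P V) mass b (BV V) <= _)%E).
  apply: mass_sub_sum => psi [Epsi sk].
  have xk : ext psi x <= k by apply: sk; rewrite !inE eqxx.
  have yk : ext psi y <= k by apply: sk; rewrite !inE eqxx orbT.
  have wk : ext psi w <= k by apply: sk; rewrite !inE eqxx !orbT.
  have [V [dV Vx VU Vb Vn]] := low_contour kh Epsi Ux xk.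
  have Vy := Vn _ _ xy Vx Uy yk.
  have Vw : ins V w by case: xyw => [xw|yw]; [exact: Vn xw _ _ _|exact: Vn yw _ _ _].
  exists V; first exact: mem_index_enum.
  by split; [rewrite /P Vx dV (boundary_ge8 Vx Vy Vw)|].
have m0 := mass_ge0 b (low s (k + 1)).
apply: le_trans (_ : (\sum_(V : {set bsite r} | P V)
    (z ^+ #|bdy V|)%:E * mass b (low s (k + 1)%R) <= _)%E).
  apply: lee_sum => V PV; have [VU|nVU] := pselect {subset ins V <= ins U}.
    by apply: le_mass_raise => // psi [] // _ [].
  rewrite (_ : BV V = set0); last by apply/seteqP; split=> // psi [_ []].
  rewrite /mass (eq_tsum (g' := fun=> 0)); last by move=> psi; rewrite in_set0.
  by rewrite /tsum esum1// mule_ge0// lee_fin exprn_ge0.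
rewrite -ge0_sume_distrl; last by move=> V _; rewrite lee_fin exprn_ge0.
apply: lee_wpmul2r => //; rewrite sumEFin lee_fin.
have z1 : 128 * z <= 1 / 2 by move: hz z0; clearbody z; nra.
apply: le_trans (@contour_sum r R x z 8 z0 z1) _.
rewrite (_ : _ * _ = (2 * 128 ^+ 8 * z) * z ^+ 7); last first.
  by rewrite exprMn (exprSr z 7); clearbody z; ring.
by rewrite ler_piMl ?exprn_ge0.
Qed.

Let M := mass b (elevated U h).

Let M0 : (0 <= M)%E. Proof. exact: mass_ge0. Qed.

Let z1 : z <= 1 / 9. Proof. by move: hz z0; clearbody z; nra. Qed.

Lemma low_top s k : (mass b (low s k) <= M)%E.
Proof. by apply: le_mass => psi []. Qed.

Lemma trimer_bound x y w j : nb x y -> nb x w \/ nb y w ->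
  x != y -> x != w -> y != w -> ins U x -> ins U y -> ins U w ->
  (mass b (low [:: x; y; w] (h%:Z - j%:Z)%R) <= (z ^+ (7 * j))%:E * M)%E.
Proof.
move=> xy xyw nxy nxw nyw Ux Uy Uw; elim: j => [|j IH].
  by rewrite muln0 expr0 mul1e low_top.
have kh := subz_succ_lt h j.
apply: le_trans (trimer_step xy xyw nxy nxw nyw Ux Uy Uw kh) _.
rewrite subz_succD1.
rewrite mulnS exprD [in leRHS]EFinM -[leRHS]muleA; apply: lee_wpmul2l => //.
by rewrite lee_fin exprn_ge0.
Qed.

Definition neighbors (x : site) : seq site :=
  [:: stp x true; stp x false; bstp x true; bstp x false].

Lemma mem_neighbors x y : nb x y -> y \in neighbors x.
Proof.
rewrite /neighbors !inE; case=> -[c] ->; first by case: c; rewrite eqxx ?orbT.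
have E d : bstp (stp y d) d = y := bstpK d y.
by case: c; rewrite E eqxx ?orbT.
Qed.

(* Raising only the dimer gains its 6 outer edges, unless a neighbor is at least as
   low, which is a trimer event.  No entropy is lost on the main term. *)
Lemma dimer_step x y k : nb x y -> x != y -> ins U x -> ins U y -> k < h%:Z ->
  (mass b (low [:: x; y] k) <= (z ^+ 6)%:E * mass b (low [:: x; y] (k + 1)%R) +
    \sum_(w <- neighbors x ++ neighbors y | [&& x != w, y != w & ins U w])
      mass b [set psi | (nb x w \/ nb y w) /\ low [:: x; y; w] k psi])%E.
Proof.
have nbsP v : nb x v \/ nb y v -> v \in neighbors x ++ neighbors y.
  by rewrite mem_cat; case=> /mem_neighbors ->; rewrite ?orbT.
move: (_ ++ _) nbsP => nbs nbsP xy nxy Ux Uy kh; pose s := [:: x; y].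
pose B0 := [set psi | low s k psi /\ forall u v, nb u v -> u \in s -> v \notin s ->
  ext psi u < ext psi v].
pose P (i : option site) := if i is Some w then [&& x != w, y != w & ins U w] else true.
pose B (i : option site) := if i is Some w then
  [set psi | (nb x w \/ nb y w) /\ low [:: x; y; w] k psi] else B0.
apply: le_trans (_ : (\sum_(i <- None :: map Some nbs | P i)
    mass b (B i) <= _)%E).
  apply: mass_sub_sum => psi lpsi; have [Epsi sk] := lpsi.
  have [B0psi|/not_andP[//|]] := pselect (B0 psi).
    by exists None; rewrite ?inE.
  move=> /existsNP[u] /existsNP[v] /not_implyP[uv] /not_implyP[us] /not_implyP[vs].
  move=> /negP; rewrite -leNgt => vu.
  have uk := sk u us.
  have us' : u = x \/ u = y.
    by move: us; rewrite !inE => /orP[] /eqP; [left|right].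
  have Uu : ins U u by move: us; rewrite !inE => /orP[] /eqP ->.
  have Uv := low_inU kh Epsi Uu uk uv.
  move: vs; rewrite !inE negb_or => /andP[vx vy].
  have vn : v \in nbs.
    by apply: nbsP; case: us' uv => ->; [left|right].
  exists (Some v); first by rewrite inE map_f ?orbT.
  rewrite /P /B; split; first by rewrite eq_sym vx eq_sym vy Uv.
  split; first by case: us' uv => ->; [left|right].
  split=> // t; rewrite !inE => /or3P[] /eqP ->.
  - by apply: sk; rewrite !inE eqxx.
  - by apply: sk; rewrite !inE eqxx orbT.
  - exact: le_trans uk.
rewrite big_cons /= big_map; apply: leeD => //.
pose V : {set bsite r} := toset r (fun u => u \in s).
have VE : ins V =1 (fun u => u \in s).
  apply: ins_toset => u; rewrite -[_ \in _]/(u \in s) !inE.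
  by move=> /orP[] /eqP ->; [exact: ins_inbox Ux|exact: ins_inbox Uy].
have VU : {subset ins V <= ins U}.
  by move=> u; rewrite [_ \in _]VE !inE => /orP[] /eqP ->.
apply: le_trans (_ : ((z ^+ #|bdy V|)%:E * mass b (low s (k + 1)%R) <= _)%E).
  apply: (le_mass_raise VU) => [psi []//|psi [_ h0] u v uv].
  by rewrite !VE; exact: h0.
apply: lee_wpmul2r; first exact: mass_ge0.
rewrite lee_fin; apply: ler_wiXn2l => //; first by move: z1; lra.
by apply: (@boundary_ge6 _ _ x y) => //; rewrite VE !inE eqxx ?orbT.
Qed.

(** The subtracted term closes the induction: one step adds at most 8 trimer terms z^(7(j+1)), one
    for each neighbor of [x] or [y], and restoring the subtracted term needs a ninth. They fit into
    the gap because 9 z <= 1. *)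
Lemma dimer_bound x y j : nb x y -> x != y -> ins U x -> ins U y ->
  (mass b (low [:: x; y] (h%:Z - j%:Z)%R) <=
   (2 * z ^+ (6 * j) - z ^+ (7 * j))%:E * M)%E.
Proof.
move=> xy nxy Ux Uy; elim: j => [|j IH].
  by rewrite !muln0 !expr0 (_ : 2 * 1 - 1 = 1) ?mul1e ?low_top//; lra.
have kh := subz_succ_lt h j.
apply: le_trans (dimer_step xy nxy Ux Uy kh) _.
rewrite subz_succD1.
set s := neighbors x ++ neighbors y.
have c0 : 0 <= z ^+ (7 * j.+1) by rewrite exprn_ge0.
apply: le_trans (_ : (z ^+ 6)%:E * ((2 * z ^+ (6 * j) - z ^+ (7 * j))%:E * M) +
    \sum_(w <- s) ((z ^+ (7 * j.+1))%:E * M) <= _)%E.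
  apply: leeD; first by apply: lee_wpmul2l => //; rewrite lee_fin exprn_ge0.
  rewrite big_mkcond; apply: lee_sum => w _.
  case: ifPn => [/and3P[xw yw Uw]|_]; last by rewrite mule_ge0.
  have [xyw|nxyw] := pselect (nb x w \/ nb y w).
    apply: le_trans (trimer_bound j.+1 xy xyw nxy xw yw Ux Uy Uw).
    by apply: le_mass => psi [].
  rewrite [X in mass b X](_ : _ = set0); last by apply/seteqP; split=> // psi [].
  by rewrite /mass /tsum esum1 ?mule_ge0// => psi _; rewrite in_set0.
rewrite -ge0_sume_distrl; last by move=> *; rewrite lee_fin.
rewrite sumEFin muleA -EFinM.
have a0 : 0 <= z ^+ 6 * (2 * z ^+ (6 * j) - z ^+ (7 * j)).
  rewrite mulr_ge0 ?exprn_ge0// subr_ge0.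
  apply: le_trans (_ : z ^+ (6 * j) <= _); last by rewrite ler_peMl ?exprn_ge0//; lra.
  by apply: ler_wiXn2l => //; [move: z1; lra|rewrite leq_mul2r orbT].
have b1 : 0 <= \sum_(i <- s) z ^+ (7 * j.+1) by rewrite sumr_ge0.
rewrite -ge0_muleDl ?lee_fin// -EFinD; apply: lee_wpmul2r => //; rewrite lee_fin.
rewrite big_const_seq count_predT iter_addr_0 /=.
rewrite (_ : z ^+ (6 * j.+1) = z ^+ 6 * z ^+ (6 * j)); last by rewrite mulnS exprD.
rewrite (_ : z ^+ (7 * j.+1) = z ^+ 6 * z * z ^+ (7 * j)); last by rewrite mulnS exprD -exprSr.
have : z ^+ 6 * z ^+ (7 * j) * (9 * z) <= z ^+ 6 * z ^+ (7 * j).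
  by rewrite ler_piMr ?mulr_ge0 ?exprn_ge0//; move: z1; clearbody z; lra.
rewrite -mulr_natl; set u := z ^+ (7 * j); set v := z ^+ (6 * j); set t := z ^+ 6.
clearbody u v t z; nra.
Qed.

End Downward.

(** * Lowering an elevated set *)

Lemma stp_neq x c : x != stp x c.
Proof.
apply/eqP => /(congr1 (fun x => (xco x, yco x))).
by rewrite !stpE; case: c => -[]; lia.
Qed.

Lemma sum_bedge_src r (U : {set bsite r}) :
  (\sum_(e : bedge r) ins U (src e) = 2 * #|U|)%N.
Proof.
rewrite (sum_bedge r (fun x _ => ins U x : nat)).
transitivity (\sum_(x <- box r.+1) 2 * ins U x)%N.
  by apply: eq_bigr => x _; rewrite mul2n -addnn.
rewrite -big_distrr /=; congr (_ * _)%N.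
transitivity (\sum_(x <- box r) ins U x)%N.
  move: (box r.+1) (mem_box r.+1) (uniq_box r.+1) => s sE us.
  rewrite [LHS](bigID (inbox r)) /= [X in (_ + X)%N]big1 ?addn0; last first.
    by move=> x; apply: contraNeq; rewrite eqb0 negbK => /ins_inbox.
  rewrite -big_filter; apply: perm_big; apply: uniq_perm.
  - by apply: filter_uniq.
  - exact: uniq_box.
  - move=> x; rewrite mem_filter sE mem_box; case xr : (inbox r x) => //=.
    exact: inboxS.
rewrite (sum_bsite r (fun x => ins U x : nat)) -sum1_card [RHS]big_mkcond.
by apply: eq_bigr => y _; rewrite insE; case: ifP.
Qed.

(** The convex function exp(-a) lies above its tangent at [m]; the linear term is moved across to
    avoid subtraction in extended reals later. *)
Lemma expR_tangent (R : realType) (m a : R) :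
  (1 + m) * expR (- m) <= expR (- a) + expR (- m) * a.
Proof.
have h : 1 + (m - a) <= expR (m - a) by exact: expR_ge1Dx.
have -> : expR (- a) = expR (- m) * expR (m - a) by rewrite -expRD; congr expR; lra.
have : 0 <= expR (- m) by exact: expR_ge0.
by move: (expR (- m)) (expR (m - a)) h => u v h u0; nra.
Qed.

Section Lowering.
Variables (R : realType) (r : nat) (b : R).
Hypothesis b0 : 0 <= b.
Let z := expR (- b).
Hypothesis hz : 2 * 128 ^+ 8 * z <= 1.
Variables (U : {set bsite r}) (h : nat).
Hypothesis cU : coconn r (ins U).
Hypothesis h0 : (0 < h)%N.

Let M := mass b (elevated U h).
Let Z := partfun r b.

Let z0 : 0 <= z. Proof. exact: expR_ge0. Qed.

Let Zfin : (Z < +oo)%E.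
Proof.
apply: le_lt_trans (ltry _); apply: partfun_le => //.
by move: hz z0; rewrite -/z; clearbody z; nra.
Qed.

Let MZ : (M <= Z)%E.
Proof. by rewrite /Z -mass_setT; exact: le_mass. Qed.

(** Each of the at most 2|U| bonds is a dimer at height at most 0, which is [dimer_bound] with
    [j = h]. *)
Lemma expected_below :
  (tsum (fun psi => wt b psi *+ (psi \in elevated U h) * (below U psi)%:R)%R <=
   (4 * #|U|%:R * z ^+ (6 * h))%:E * M)%E.
Proof.
have E psi : wt b psi *+ (psi \in elevated U h) * (below U psi)%:R =
    \sum_(e : bedge r | ins U (src e) && ins U (tgt e))
      wt b psi *+ (psi \in low U h [:: src e; tgt e] 0).
  rewrite /below natr_sum mulr_sumr; apply: eq_bigr => e _.
  case: (boolP (psi \in elevated U h)) => [/set_mem Epsi|nE]; last first.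
    rewrite mulr0n mul0r memNset ?mulr0n// => -[Epsi _].
    by rewrite mem_set in nE.
  rewrite mulr1n mulr_natr; congr (_ *+ nat_of_bool _).
  apply/andP/idP => [[s0 t0]|/set_mem[_ st]].
    apply/mem_set; split=> // x.
    by rewrite !inE => /orP[] /eqP ->.
  by split; apply: st; rewrite !inE eqxx ?orbT.
rewrite (eq_tsum E) tsum_sum; last by move=> *; exact: wtn_ge0.
have c0 : 0 <= 2 * z ^+ (6 * h) by rewrite mulr_ge0// exprn_ge0.
have M0 : (0 <= M)%E by exact: mass_ge0.
apply: le_trans (_ : \sum_(e : bedge r | ins U (src e) && ins U (tgt e))
   ((2 * z ^+ (6 * h))%:E * M) <= _)%E.
  apply: lee_sum => e /andP[Us Ut]; have := nb_src_tgt e => st.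
  have ne : src e != tgt e.
    exact: stp_neq.
  have := @dimer_bound R r b b0 hz U h cU _ _ h st ne Us Ut.
  rewrite subrr => H; apply: (le_trans H); apply: lee_wpmul2r => //.
  by rewrite lee_fin gerBl exprn_ge0.
rewrite -ge0_sume_distrl; last by move=> *; rewrite lee_fin.
apply: lee_wpmul2r => //; rewrite sumEFin lee_fin sumr_const -[leLHS]mulr_natl.
rewrite (_ : 4 * _ * _ = (2 * #|U|)%:R * (2 * z ^+ (6 * h))); last first.
  by rewrite natrM; clearbody z; ring.
apply: ler_wpM2r => //; rewrite ler_nat -sum_bedge_src -sum1_card big_mkcond /=.
by apply: leq_sum => e _; rewrite !unfold_in; case: (ins U (src e)); case: (ins U (tgt e)).
Qed.

(* Jensen's inequality for [exp (- 2 b below)], through the tangent line at the mean. *)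
Lemma le_elevated :
  (M <= (expR (8 * b * #|U|%:R * z ^+ (6 * h)) * z ^+ #|bdy U|)%:E * Z)%E.
Proof.
set m := 8 * b * _ * _.
have m0 : 0 <= m by rewrite !mulr_ge0// exprn_ge0.
pose w psi := wt b psi *+ (psi \in elevated U h).
have w0 psi : 0 <= w psi by exact: wtn_ge0.
pose X := tsum (fun psi => w psi * expR (- (2 * b * (below U psi)%:R))).
have XZ : (X <= (z ^+ #|bdy U|)%:E * Z)%E.
  rewrite /Z /partfun -tsumZ; [|by rewrite exprn_ge0|by move=> ?; exact: wt_ge0].
  apply: (@le_tsum_inj _ _ _ (elevated U h) (shift_on U (-1))).
  - by move=> psi psi' _ _; exact: shift_on_inj.
  - by move=> psi; rewrite mulr_ge0 ?wt_ge0// exprn_ge0.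
  - move=> psi Epsi; rewrite /w mem_set// mulr1n !wtE.
    have -> : expR (- (2 * b * (below U psi)%:R)) = z ^+ (2 * below U psi).
      by rewrite -expRM_natl natrM; congr expR; ring.
    rewrite -!exprD [X in z ^+ X]addnC; apply: ler_wiXn2l => //.
      by rewrite -expR0 ler_expR oppr_le0.
    by have H := energy_lower h0 Epsi; clear -H; lia.
  - by move=> psi nE; rewrite /w memNset// mulr0n mul0r.
have key : (((1 + m) * expR (- m))%:E * M <= X + (expR (- m) * m)%:E * M)%E.
  have e0 : 0 <= expR (- m) by exact: expR_ge0.
  apply: le_trans (_ : X + (expR (- m) * (2 * b))%:E *
      tsum (fun psi => (w psi * (below U psi)%:R)%R) <= _)%E.
    rewrite -tsumZ; [|by rewrite mulr_ge0// addr_ge0|exact: w0].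
    rewrite -tsumZ; [|by rewrite !mulr_ge0|by move=> psi; rewrite mulr_ge0].
    rewrite -tsumD; [|by move=> psi; rewrite mulr_ge0// expR_ge0
      |by move=> psi; rewrite !mulr_ge0].
    apply: le_tsum => psi; rewrite -/(w psi).
    have H := ler_wpM2l (w0 psi) (expR_tangent m (2 * b * (below U psi)%:R)).
    rewrite mulrC; apply: (le_trans H); rewrite le_eqVlt; apply/orP; left.
    by apply/eqP; ring.
  rewrite leeD2l//.
  apply: le_trans (_ : (expR (- m) * (2 * b))%:E *
     ((4 * #|U|%:R * z ^+ (6 * h))%:E * M) <= _)%E.
    apply: lee_wpmul2l; first by rewrite lee_fin !mulr_ge0.
    exact: expected_below.
  rewrite muleA -EFinM /m le_eqVlt; apply/orP; left; apply/eqP.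
  by congr (_%:E * _)%E; ring.
(* Finiteness allows cancelling e^(-m) m M from both sides of [key], which leaves e^(-m) M <= X. *)
have Mfin : (M < +oo)%E by exact: le_lt_trans MZ Zfin.
have M0 : (0 <= M)%E by exact: mass_ge0.
have Z0 : (0 <= Z)%E by apply: tsum_ge0 => psi; exact: wt_ge0.
have X0 : (0 <= X)%E by apply: tsum_ge0 => psi; rewrite mulr_ge0// expR_ge0.
move: Mfin M0 Z0 X0 Zfin XZ key; clearbody M Z X.
case: M => [M'| |]//; case: Z => [Z'| |]//; case: X => [X'| |]// _.
rewrite -!EFinM -!EFinD !lee_fin => M0 Z0 X0 _ XZ key.
have e0 : 0 < expR (- m) by exact: expR_gt0.
have em : expR m * expR (- m) = 1 by rewrite -expRD subrr expR0.
have h1 : expR (- m) * M' <= z ^+ #|bdy U| * Z'.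
  apply: le_trans XZ; move: key; move: (expR (- m)) => e key.
  by rewrite -(lerD2r (e * m * M')); apply: le_trans key; rewrite le_eqVlt;
    apply/orP; left; apply/eqP; ring.
have := ler_wpM2l (expR_ge0 m) h1; rewrite mulrA em mul1r => h2.
by apply: le_trans h2 _; rewrite mulrA.
Qed.

End Lowering.

(** * Families of outermost contours *)

Lemma prod1D_subset (R : realType) (I : finType) (A : {set I}) (u : I -> R) :
  \prod_(i in A) (1 + u i) = \sum_(J : {set I} | J \subset A) \prod_(i in J) u i.
Proof.
rewrite big_mkcond (eq_bigr (fun i => u i *+ (i \in A) + 1)); last first.
  by move=> i _; case: ifP => _; rewrite ?mulr1n ?mulr0n ?add0r// addrC.
rewrite (bigA_distr _ _ (fun i => u i *+ (i \in A)) (fun=> 1)) [RHS]big_mkcond.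
apply: eq_bigr => J _; case: ifPn => [/fintype.subsetP JA|/subsetPn[i iJ iA]].
  rewrite [RHS]big_mkcond; apply: eq_bigr => i _.
  by case: ifP => // /JA ->.
by rewrite (bigD1 i)//= iJ (negbTE iA) mulr0n mul0r.
Qed.

Lemma esc_all r x : esc r pred0 x.
Proof.
move: {2}(absz (r%:Z + 1 - xco x)%R) (erefl (absz (r%:Z + 1 - xco x)%R)) => k.
elim: k x => [|k IH] x kE; first by apply: esc_right => //; lia.
have [rx|xr] := ltP r%:Z (xco x); first exact: esc_right.
apply: (@esc_step _ _ _ (stp x true)) => //; first by left; exists true.
by apply: IH; rewrite stpE; lia.
Qed.

Lemma esc_hull r (A : pred site) x : esc r A x -> esc r (hull r A) x.
Proof.
move=> h; elim: h => {x} [x xr Ax|x y Ax xy ey IH].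
  by apply: esc_right => //; apply/hullPn; apply: esc_right.
by apply: (esc_step _ xy IH); apply/hullPn; exact: (esc_step Ax xy ey).
Qed.

Section Family.
Variables (r h : nat) (psi : config r).
Hypothesis h0 : (0 < h)%N.
Implicit Types (V : {set bsite r}) (F : {set {set bsite r}}).

Definition high : pred site := fun x => h%:Z <= ext psi x.

Definition outer : {set {set bsite r}} :=
  [set V | `[< exists2 e, cross (hull r high) e &
                 V = toset r (contour r high e) >]].

Lemma high_inbox : {subset high <= inbox r}.
Proof.
move=> x hx; have {}hx : h%:Z <= ext psi x := hx.
suff : inbox r x by []; apply: contraTT hx => xr.
by rewrite ext_out// -ltNge ltz_nat.
Qed.

Lemma outer_dconn V : V \in outer -> dconn V.
Proof. by rewrite inE => /asboolP[e He ->]; apply: contour_dconn => //; exact: high_inbox. Qed.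

Lemma outer_boundary V x y : V \in outer -> nb x y -> ins V x -> ~~ ins V y ->
  high x /\ ~~ hull r high y.
Proof.
rewrite inE => /asboolP[e He ->] xy; rewrite !contour_setE//; try exact: high_inbox.
by apply: contour_boundary => //; exact: high_inbox.
Qed.

Lemma outer_sub_hull V x : V \in outer -> ins V x -> hull r high x.
Proof.
rewrite inE => /asboolP[e He ->]; rewrite contour_setE//; last exact: high_inbox.
by apply: contour_sub_hull => //; exact: high_inbox.
Qed.

Lemma outer_disjoint V W e : V \in outer -> W \in outer ->
  e \in bdy V -> e \in bdy W -> V = W.
Proof.
rewrite inE => /asboolP[f Hf ->]; rewrite inE => /asboolP[g Hg ->].
rewrite !inE; have [E _ _|h1] := contour_eq_or_disjoint high_inbox Hf Hg.
  by apply/setP => y; rewrite !inE E.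
have E f' : cross (hull r high) f' -> ins (toset r (contour r high f')) = contour r high f'.
  by move=> Hf'; apply/funext; apply: contour_setE => //; exact: high_inbox.
by rewrite !E// => h2 h3; have := h1 (ed e); rewrite h2 h3.
Qed.

Section Union.
Variable F : {set {set bsite r}}.
Hypothesis FO : F \subset outer.

Definition union_of : {set bsite r} := \bigcup_(V in F) V.

Lemma ins_union x : ins union_of x <-> exists2 V, V \in F & ins V x.
Proof.
split=> [/ins_val[y <-] /bigcupP[V VF yV]|[V VF /ins_val[y <- yV]]].
  by exists V; rewrite // insE.
by rewrite insE; apply/bigcupP; exists V.
Qed.

Let FO' V : V \in F -> V \in outer. Proof. exact: (fintype.subsetP FO). Qed.

Lemma union_boundary x y : nb x y -> ins union_of x -> ~~ ins union_of y ->
  high x /\ ~~ hull r high y.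
Proof.
move=> xy /ins_union[V VF Vx] Uy; apply: (outer_boundary (FO' VF) xy Vx).
by apply: contra Uy => Vy; apply/ins_union; exists V.
Qed.

Lemma union_sub_hull x : ins union_of x -> hull r high x.
Proof. by move=> /ins_union[V VF]; apply: outer_sub_hull; exact: FO'. Qed.

(** Follow an unrestricted path to infinity. Just before it would enter the union, the current site
    lies outside the hull, and from there an escape avoids the whole hull, hence the union. *)
Lemma union_coconn : coconn r (ins union_of).
Proof.
move=> x; elim: (esc_all r x) => {x} [x xr _ Ux|x y _ xy _ IH Ux].
  exact: esc_right.
have [Uy|Uy] := boolP (ins union_of y); last exact: esc_step xy (IH Uy).
have [_ /hullPn/esc_hull] := union_boundary (nbC xy) Uy Ux.
by apply: esc_mono => t; exact: union_sub_hull.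
Qed.

Lemma union_elevated : elevated union_of h psi.
Proof.
move=> x y xy Ux Uy; have [hx hy] := union_boundary xy Ux Uy.
split=> //; rewrite ltNge; apply: contra hy; exact: sub_hull.
Qed.

Lemma bdy_union V e : V \in F -> e \in bdy V -> e \in bdy union_of.
Proof.
move=> VF; have VO := FO' VF; rewrite !inE /cross.
have out x y : nb x y -> ins V x -> ~~ ins V y -> ins union_of x && ~~ ins union_of y.
  move=> xy Vx Vy; have [_ hy] := outer_boundary VO xy Vx Vy.
  apply/andP; split; first by apply/ins_union; exists V.
  by apply: contra hy; exact: union_sub_hull.
have xy := nb_src_tgt e; rewrite -/(tgt e) -/(src e).
case s : (ins V (src e)); case t : (ins V (tgt e)) => //= _.
  by have /andP[-> /negbTE ->] := out _ _ xy s (negbT t).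
by have /andP[-> /negbTE ->] := out _ _ (nbC xy) t (negbT s).
Qed.

(** Distinct members share no boundary edge. The outer end of each boundary edge is outside the
    hull, so no other member covers it and the edge survives in the union. *)
Lemma sum_bdy_le : (\sum_(V in F) #|bdy V| <= #|bdy union_of|)%N.
Proof.
have E V : #|bdy V| = (\sum_(e : bedge r) (e \in bdy V))%N.
  by rewrite -sum1_card big_mkcond; apply: eq_bigr => e _; case: ifP.
rewrite E (eq_bigr _ (fun V _ => E V)) exchange_big /=; apply: leq_sum => e _.
have [/exists_inP[V VF eV]|/exists_inPn h1] := boolP [exists V in F, e \in bdy V].
  rewrite (bdy_union VF eV) (bigD1 V)//= eV big1// => W /andP[WF WV].
  apply/eqP; rewrite eqb0; apply: contra WV => eW; apply/eqP.
  exact: outer_disjoint (FO' WF) (FO' VF) eW eV.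
by rewrite big1// => V VF; rewrite (negbTE (h1 V VF)).
Qed.

End Union.

Lemma card_high_le :
  (#|[pred y : bsite r | (h%:Z <= psi y)%R]| <= \sum_(V in outer) #|V|)%N.
Proof.
apply: (@leq_trans #|finset.cover outer|); last by case: (leq_card_cover outer).
apply/subset_leq_card/fintype.subsetP => y; rewrite inE => hy.
have Hy : hull r high (val y) by apply: sub_hull; rewrite /high ext_val.
have [e He ey] := contour_at high_inbox Hy.
apply/bigcupP; exists (toset r (contour r high e)).
  by rewrite inE; apply/asboolP; exists e.
by rewrite -insE.
Qed.

End Family.

(** * Exponential moment of the area above a level *)

Section UpperTail.
Variables (R : realType) (r h : nat) (b : R).
Hypothesis b0 : 0 <= b.
Let z := expR (- b).
Let y := expR (- (b / 2)).
Let side : R := (r.*2.+1)%:R.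
Hypothesis hz : 2 * 128 ^+ 8 * z <= 1.
Hypothesis h0 : (0 < h)%N.
Hypothesis hside : 16 * side * z ^+ (6 * h) <= 1.
Hypothesis hy : 128 * (expR 1 * y) <= 1 / 2.
Implicit Types (psi : config r) (V : {set bsite r}).

Let Z := partfun r b.
Let Z0 : (0 <= Z)%E. Proof. by apply: tsum_ge0 => psi; exact: wt_ge0. Qed.
Let y0 : 0 <= y. Proof. exact: expR_ge0. Qed.
Let side0 : 0 < side. Proof. by rewrite ltr0n. Qed.

(** By |U| <= side |bdy U| and [hside], the loss is at most b/2 per boundary edge, half of the gain;
    hence the weight [y] in place of [z]. *)
Lemma peierls (U : {set bsite r}) : coconn r (ins U) ->
  (mass b (elevated U h) <= (y ^+ #|bdy U|)%:E * Z)%E.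
Proof.
move=> cU; apply: le_trans (le_elevated b0 hz cU h0) _.
apply: lee_wpmul2r => //; rewrite lee_fin -/z.
have zh : 0 <= z ^+ (6 * h) by rewrite exprn_ge0// expR_ge0.
have c : #|U|%:R <= side * #|bdy U|%:R by rewrite -natrM ler_nat card_le_boundary.
move: hside zh; move: (z ^+ (6 * h)) => t ht t0.
rewrite /z /y -!expRM_natl -expRD ler_expR.
have h1 : 8 * b * #|U|%:R * t <= 8 * b * (side * #|bdy U|%:R) * t.
  by rewrite ler_wpM2r// ler_wpM2l// mulr_ge0.
have h2 : b / 2 * #|bdy U|%:R * (16 * side * t) <= b / 2 * #|bdy U|%:R.
  by rewrite ler_piMr// mulr_ge0// divr_ge0.
have h3 : 8 * b * (side * #|bdy U|%:R) * t = b / 2 * #|bdy U|%:R * (16 * side * t).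
  by field.
lra.
Qed.

(** The product of 1 + u V over contours is the exponential of the enclosed area at rate 1/side; at
    this rate a contour pays at most a factor e per boundary edge. *)
Let u V : R := expR (#|V|%:R / side) - 1.

Let u0 V : 0 <= u V.
Proof. by rewrite subr_ge0 -expR0 ler_expR divr_ge0// ltW. Qed.

(** All members are lowered at once: their union is elevated and without holes, and its boundary is
    at least as long as theirs together. The factor [dconn] restricts later sums to genuine
    contours. *)
Lemma family_mass (F : {set {set bsite r}}) :
  (mass b [set psi | F \subset outer h psi] <=
   (\prod_(V in F) (y ^+ #|bdy V| *+ dconn V))%:E * Z)%E.
Proof.
have [[psi0 Fpsi0]|/forallNP none] := pselect (exists psi, F \subset outer h psi); last first.
  rewrite (_ : [set _ | _] = set0); last by apply/seteqP; split=> // psi /none.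
  rewrite /mass /tsum esum1; last by move=> psi _; rewrite in_set0.
  by rewrite mule_ge0// lee_fin prodr_ge0// => V _; rewrite mulrn_wge0// exprn_ge0.
apply: le_trans (_ : mass b (elevated (union_of F) h) <= _)%E.
  by apply: le_mass => psi; exact: union_elevated.
apply: le_trans (peierls (union_coconn h0 Fpsi0)) _.
apply: lee_wpmul2r => //; rewrite lee_fin.
rewrite (eq_bigr (fun V => y ^+ #|bdy V|)) => [|V VF]; last first.
  by rewrite (outer_dconn h0 (fintype.subsetP Fpsi0 V VF)).
rewrite prodrXr; apply: ler_wiXn2l => //; last exact: (sum_bdy_le h0 Fpsi0).
by rewrite -expR0 ler_expR oppr_le0 divr_ge0.
Qed.

(** Use e^t - 1 <= t e^t with t = |V| / side <= |bdy V|. The factor |V| is spent on marking an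
    enclosed site, and [contour_sum] gives 2 * 128 q for each of the side^2 sites. *)
Lemma sum_contour_le :
  \sum_(V : {set bsite r}) u V * (y ^+ #|bdy V| *+ dconn V) <=
  side * (256 * (expR 1 * y)).
Proof.
set q := expR 1 * y; have q0 : 0 <= q by rewrite mulr_ge0// expR_ge0.
apply: le_trans (_ : \sum_(V : {set bsite r}) \sum_(x : bsite r | x \in V)
    side^-1 * (q ^+ #|bdy V| *+ dconn V) <= _).
  apply: ler_sum => V _; rewrite sumr_const -[leRHS]mulr_natl.
  case: (dconn V); last by rewrite !mulr0n !mulr0.
  rewrite !mulr1n; have t0 : 0 <= #|V|%:R / side by rewrite divr_ge0// ltW.
  have tb : #|V|%:R / side <= #|bdy V|%:R.
    by rewrite ler_pdivrMr// mulrC -natrM ler_nat card_le_boundary.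
  have h1 : u V <= #|V|%:R / side * expR (#|V|%:R / side).
    rewrite /u; set t := _ / _; have := expR_ge1Dx (- t).
    have := expRxMexpNx_1 t; have := expR_ge0 t.
    by move: (expR t) (expR (- t)) => e f e0 ef ft; nra.
  have h2 : expR (#|V|%:R / side) <= expR 1 ^+ #|bdy V|.
    by rewrite -expRM_natl mulr1 ler_expR.
  rewrite exprMn !mulrA; apply: ler_wpM2r; first exact: exprn_ge0.
  by apply: le_trans h1 _; apply: ler_wpM2l.
rewrite (exchange_big_dep xpredT)//=.
apply: le_trans (_ : \sum_(x : bsite r) side^-1 * (256 * q) <= _).
  apply: ler_sum => x _; rewrite -mulr_sumr ler_wpM2l ?invr_ge0 ?(ltW side0)//.
  have := @contour_sum r R (val x) q 1 q0 hy; rewrite expr1 mulrA -natrM.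
  apply: le_trans; rewrite [leRHS]big_mkcond [leLHS]big_mkcond /=.
  apply: ler_sum => V _; rewrite insE; case: (x \in V) => //=.
  case dV : (dconn V) => //=; rewrite (_ : (1 <= _)%N = true) ?mulr1n//.
  have /asboolP[e /cross_ed[f _ fV] _] := dV.
  by rewrite card_gt0; apply/set0Pn; exists f.
rewrite sumr_const card_bsite -[leLHS]mulr_natl natrX -/side.
by rewrite expr2 mulrA mulfK// gt_eqF.
Qed.

(** A Chernoff bound. The product of 1 + u V over the outermost contours expands over subfamilies,
    [family_mass] factorises each term, and the expansion resums to a product bounded by an
    exponential. *)
Lemma upper_tail (N : R) :
  (mass b [set psi | (N <= #|[pred x : bsite r | (h%:Z <= psi x)%R]|%:R)%R] <=
   (expR (- (N / side) + side * (256 * (expR 1 * y))))%:E * Z)%E.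
Proof.
rewrite expRD EFinM -muleA.
pose g psi := \prod_(V in outer h psi) (1 + u V).
have g0 psi : 0 <= g psi by rewrite prodr_ge0// => V _; rewrite addr_ge0.
apply: le_trans (_ : (expR (- (N / side)))%:E *
    tsum (fun psi => (wt b psi * g psi)%R) <= _)%E.
  rewrite -tsumZ ?expR_ge0//; last by move=> psi; rewrite mulr_ge0 ?wt_ge0.
  apply: le_tsum => psi; case: (boolP (psi \in _)) => [/set_mem /= Npsi|_]; last first.
    by rewrite mulr0n !mulr_ge0 ?expR_ge0 ?wt_ge0.
  rewrite mulr1n mulrCA ler_peMr ?wt_ge0// expRN mulrC ler_pdivlMr ?expR_gt0// mul1r.
  rewrite /g (eq_bigr (fun V => expR (#|V|%:R / side))); last first.
    by move=> V _; rewrite /u addrC subrK.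
  rewrite -expR_sum ler_expR -mulr_suml ler_wpM2r ?invr_ge0 ?(ltW side0)//.
  by apply: le_trans Npsi _; rewrite -natr_sum ler_nat card_high_le.
apply: lee_wpmul2l; first by rewrite lee_fin expR_ge0.
have E psi : wt b psi * g psi = \sum_(F : {set {set bsite r}})
    \prod_(V in F) u V * (wt b psi *+ (psi \in [set psi | F \subset outer h psi])).
  rewrite /g prod1D_subset mulr_sumr big_mkcond; apply: eq_bigr => F _.
  case: ifPn => [FO|nFO]; first by rewrite mem_set// mulr1n mulrC.
  by rewrite memNset ?mulr0n ?mulr0//=; exact/negP.
have pu F : 0 <= \prod_(V in F) u V by rewrite prodr_ge0.
rewrite (eq_tsum E) tsum_sum; last by move=> F psi; rewrite mulr_ge0// wtn_ge0.
apply: le_trans (_ : \sum_(F : {set {set bsite r}})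
  ((\prod_(V in F) (u V * (y ^+ #|bdy V| *+ dconn V)))%:E * Z) <= _)%E.
  apply: lee_sum => F _; rewrite tsumZ//; last by move=> psi; exact: wtn_ge0.
  rewrite big_split EFinM -muleA; apply: lee_wpmul2l; first by rewrite lee_fin.
  exact: family_mass.
have t0 V : 0 <= u V * (y ^+ #|bdy V| *+ dconn V).
  by rewrite mulr_ge0// mulrn_wge0// exprn_ge0.
rewrite -ge0_sume_distrl; last by move=> F _; rewrite lee_fin prodr_ge0.
apply: lee_wpmul2r => //; rewrite sumEFin lee_fin.
rewrite (eq_bigl (fun F : {set {set bsite r}} => F \subset [set: {set bsite r}])%SET); last first.
  by move=> F; rewrite finset.subsetT.
rewrite -prod1D_subset.
apply: le_trans (_ : \prod_(V in [set: {set bsite r}]%SET)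
    expR (u V * (y ^+ #|bdy V| *+ dconn V)) <= _).
  by apply: ler_prod => V _; rewrite addr_ge0//= expR_ge1Dx.
rewrite -expR_sum ler_expR (eq_bigl xpredT) ?sum_contour_le// => V.
by rewrite finset.in_setT.
Qed.

End UpperTail.

(** * Lower tail *)

(** The head is the bond of the dimer, the other six form its boundary. *)
Definition dimer_edges (x : site) : seq edge :=
  [:: (x, true); (bstp x true, true); (stp x true, true); (x, false);
      (bstp x false, false); (stp x true, false); (bstp (stp x true) false, false)].

Lemma dimer_edges_inj i x x' : (i < 7)%N ->
  nth (x, true) (dimer_edges x) i = nth (x', true) (dimer_edges x') i -> x = x'.
Proof.
have bi c := can_inj (stpK c); have si c := can_inj (bstpK c).
case: i => [|[|[|[|[|[|[|//]]]]]]] _ /= /(congr1 fst) /=.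
- by [].
- exact: bi.
- exact: si.
- by [].
- exact: bi.
- exact: si.
- by move/bi/si.
Qed.

Section LowerConfig.
Variable r : nat.
Implicit Types (psi : config r) (S : {set bsite r}) (c : 'I_3 * 'I_3).

Definition flat psi (x : site) : bool :=
  all (fun e => [&& inbox r e.1, inbox r (stp e.1 e.2) &
                    ext psi e.1 == ext psi (stp e.1 e.2)]) (dimer_edges x).

(** Adding [r] makes the coordinates of box sites nonnegative, so [absz] preserves residues. Within
    a class, a dimer and the site to its left meet no other dimer. *)
Definition in_class c (x : site) : bool :=
  (absz (xco x + r%:Z)%R %% 3 == c.1)%N && (absz (yco x + r%:Z)%R %% 3 == c.2)%N.

(** After the surface is raised these sites are at height at most [k], so digging a dimer to 0 costs
    at most [k] on each of its six outer bonds. *)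
Definition flat_sites (k : nat) c psi : {set bsite r} :=
  [set x : bsite r | [&& in_class c (val x), flat psi (val x), 0 <= psi x & psi x + 1 <= k%:Z]].

Definition dimer (x : site) : pred site := fun y => (y == x) || (y == stp x true).

Definition dug S : pred site := fun y => [exists x in S, dimer (val x) y].

Definition dig S psi : config r :=
  [ffun y => if dug S (val y) then 0 else psi y + 1].

Lemma flat_edge psi x i : flat psi x -> (i < 7)%N ->
  let e := nth (x, true) (dimer_edges x) i in
  [/\ inbox r e.1, inbox r (stp e.1 e.2) & ext psi e.1 = ext psi (stp e.1 e.2)].
Proof.
move=> /all_nthP h i7; have := h (x, true) i i7.
by move=> /and3P[h1 h2 /eqP h3].
Qed.

Lemma flat_dimer psi x : flat psi x ->
  [/\ inbox r x, inbox r (stp x true) & ext psi (stp x true) = ext psi x].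
Proof. by move=> /(@flat_edge _ _ 0)/(_ isT)[]. Qed.

Lemma flat_nb psi x s t : flat psi x -> dimer x s -> ~~ dimer x t -> nb s t ->
  inbox r t /\ ext psi t = ext psi x.
Proof.
move=> fx; have [xr x1r x1E] := flat_dimer fx.
have bK u d : stp (bstp u d) d = u := stpK d u.
have sK u d : bstp (stp u d) d = u := bstpK d u.
have f i := @flat_edge _ _ i fx.
move=> /orP[] /eqP ->; rewrite /dimer negb_or => /andP[/eqP t1 /eqP t2] [] [d tE].
- case: d tE => tE; first by case: t2.
  by rewrite tE; have [_ h1 h2] := f 3 isT; split=> //; rewrite -h2.
- have {}tE : t = bstp x d by rewrite tE sK.
  case: d tE => ->.
    by have [h1 _ h2] := f 1 isT; split=> //; rewrite [LHS]h2 /= bK.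
  by have [h1 _ h2] := f 4 isT; split=> //; rewrite [LHS]h2 /= bK.
- rewrite -x1E; case: d tE => ->.
    by have [_ h1 h2] := f 2 isT; split=> //; rewrite -h2.
  by have [_ h1 h2] := f 5 isT; split=> //; rewrite -h2.
- rewrite -x1E; case: d tE => tE.
    by case: t1; rewrite -[LHS](sK t true) -tE sK.
  have {tE} -> : t = bstp (stp x true) false by rewrite tE sK.
  by have [h1 _ h2] := f 6 isT; split=> //; rewrite [LHS]h2 /= bK.
Qed.

Lemma in_class_spacing c x y : in_class c x -> in_class c y -> inbox r x ->
  inbox r y -> [/\ x != stp y true, bstp x true != y & bstp x true != stp y true].
Proof.
move=> /andP[/eqP h1 _] /andP[/eqP h2 _] xr yr; split; apply/eqP => /(congr1 xco);
  rewrite /bstp ?stpE /=; move: xr yr h1 h2; rewrite /inbox; lia.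
Qed.

Lemma ext_dig psi S y :
  ext (dig S psi) y = if inbox r y then (if dug S y then 0 else ext psi y + 1) else 0.
Proof.
have [yr|yr] := boolP (inbox r y); last by rewrite ext_out.
by have [u <-] := inbox_val yr; rewrite !ext_val ffunE.
Qed.

Definition neg_edges psi : nat :=
  (\sum_(e : bedge r) ((ext psi (src e) < 0)%R && (ext psi (tgt e) < 0)%R))%N.

Lemma dugP k c S psi y : S \subset flat_sites k c psi -> dug S y ->
  exists2 x : bsite r, x \in S & [/\ flat psi (val x), dimer (val x) y,
    inbox r y, ext psi y = ext psi (val x) & 0 <= ext psi y /\ ext psi y + 1 <= k%:Z].
Proof.
move=> /fintype.subsetP SF /existsP[x /andP[xS xy]]; exists x => //.
have := SF _ xS; rewrite inE => /and4P[_ fx x0 xk].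
have [xr x1r x1E] := flat_dimer fx; rewrite ext_val in x1E.
have yE : ext psi y = psi x.
  by move: xy => /orP[] /eqP ->; rewrite ?ext_val.
rewrite yE ext_val; split=> //.
by move: xy => /orP[] /eqP ->.
Qed.

Lemma bcost_dig k c S psi (e : bedge r) : S \subset flat_sites k c psi ->
  (bcost (ext (dig S psi) (src e)) (ext (dig S psi) (tgt e)) +
   2 * ((ext psi (src e) < 0)%R && (ext psi (tgt e) < 0)%R) <=
   bcost (ext psi (src e)) (ext psi (tgt e)) + cross (inbox r) (ed e) +
   k * cross (dug S) (ed e))%N.
Proof.
move=> SF; rewrite /cross -/(tgt e) -/(src e).
move: (src e) (tgt e) (nb_src_tgt e) => s t.
have nbr u v : nb u v -> dug S u -> ~~ dug S v ->
    [/\ inbox r v, 0 <= ext psi v & ext psi v + 1 <= k%:Z].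
  move=> uv du dv; have [x xS [fx xu _ uE [u0 uk]]] := dugP SF du.
  have xv : ~~ dimer (val x) v.
    by apply: contra dv => xv; apply/existsP; exists x; rewrite xS.
  by have [vr vE] := flat_nb fx xu xv uv; rewrite vE -uE.
have dug_in u : dug S u -> inbox r u /\ 0 <= ext psi u.
  by move=> /(dugP SF)[x _ [_ _ ur _ []]].
(* By symmetry of the cost it is enough to treat an undug [v]; a bond with both ends dug costs
   nothing afterwards. *)
have half u v : nb u v -> ~~ dug S v ->
    (bcost (ext (dig S psi) u) (ext (dig S psi) v) +
     2 * ((ext psi u < 0)%R && (ext psi v < 0)%R) <=
     bcost (ext psi u) (ext psi v) + (inbox r u (+) inbox r v) +
     k * (dug S u (+) dug S v))%N.
  move=> uv dv; rewrite !ext_dig (negbTE dv) addbF.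
  case du : (dug S u) => /=.
    have [vr v0 vk] := nbr _ _ uv du dv; have [ur u0] := dug_in _ du.
    rewrite ur vr [X in (2 * nat_of_bool X)%N](_ : _ = false); last by rewrite ltNge u0.
    rewrite muln0 muln1 !addn0; apply: leq_trans (leq_addl _ _).
    by rewrite /bcost; move: v0 vk; case: (ext psi v) => m //= _; lia.
  have [ur|ur] := boolP (inbox r u); have [vr|vr] := boolP (inbox r v) => /=.
  - by rewrite bcost_up_up muln0 !addn0.
  - rewrite (ext_out psi vr) ltxx andbF muln0 !addn0; exact: bcost_up_le.
  - rewrite (ext_out psi ur) ltxx muln0 !addn0 bcostC [X in (_ <= X + _)%N]bcostC.
    exact: bcost_up_le.
  - by rewrite !ext_out.
move=> st; have [dt|dt] := boolP (dug S t); last by have := half _ _ st dt; rewrite (negbTE dt).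
have [ds|ds] := boolP (dug S s).
  have [sr s0] := dug_in _ ds; have [tr t0] := dug_in _ dt.
  by rewrite !ext_dig sr tr ds dt [X in (2 * nat_of_bool X)%N](_ : _ = false)// ltNge s0.
have := half _ _ (nbC st) ds; rewrite dt (negbTE ds) /=.
by rewrite andbC addbC bcostC [X in (_ <= X + _ + _)%N]bcostC.
Qed.

Lemma card_box_boundary :
  (\sum_(e : bedge r) cross (inbox r) (ed e) <= r.*2.+1 * 4)%N.
Proof.
rewrite sum_nat_of_bool.
have -> : (r.*2.+1 * 4)%N = #|[set: 'I_(r.*2.+1) * (bool * bool)]%SET|.
  by rewrite cardsT !card_prod card_ord card_bool.
pose rel (e : bedge r) (p : 'I_(r.*2.+1) * (bool * bool)) :=
  [/\ e.2 = p.2.1, (0 <= (if e.2 then xco (ed e).1 else yco (ed e).1)) = p.2.2 &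
    (p.1 : nat)%:Z = (if e.2 then yco (ed e).1 else xco (ed e).1) + r%:Z].
apply: (@leq_card_rel _ _ _ _ rel).
  move=> [s []]; rewrite inE /cross /inbox !stpE /= => ce.
    have hi : (absz (yco (ssval s) + r%:Z)%R < r.*2.+1)%N by lia.
    exists (Ordinal hi, (true, 0 <= xco (ssval s))); first exact: finset.in_setT.
    by split=> //=; lia.
  have hi : (absz (xco (ssval s) + r%:Z)%R < r.*2.+1)%N by lia.
  exists (Ordinal hi, (false, 0 <= yco (ssval s))); first exact: finset.in_setT.
  by split=> //=; lia.
move=> [s d] [s' d'] [i [d0 b]]; rewrite !inE => c1 c2 [/= dE h1 h2] [/= dE' h3 h4].
move: c1 c2 h1 h2 h3 h4; rewrite dE dE' {dE dE'} => c1 c2 h1 h2 h3 h4.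
congr (_, _); apply/val_inj; move: c1 c2 h1 h2 h3 h4.
rewrite /cross /inbox !stpE /=; case: d0 => /= c1 c2 h1 h2 h3 h4;
  case: b h1 h3 => h1 h3; apply: site_eq; lia.
Qed.

Lemma card_dug_boundary S :
  (\sum_(e : bedge r) cross (dug S) (ed e) <= 6 * #|S|)%N.
Proof.
apply: (@leq_trans (\sum_(e : bedge r) \sum_(x in S) cross (dimer (val x)) (ed e))%N).
  apply: leq_sum => e _; case ce : (cross _ _) => //.
  suff [x xS cx] : exists2 x, x \in S & cross (dimer (val x)) (ed e).
    by rewrite (bigD1 x)//= cx leq_addr.
  have half u v : dug S u -> ~~ dug S v -> exists2 x, x \in S &
      dimer (val x) u && ~~ dimer (val x) v.
    move=> /existsP[x /andP[xS xu]] dv; exists x => //; rewrite xu /=.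
    by apply: contra dv => xv; apply/existsP; exists x; rewrite xS.
  move: ce; rewrite /cross; set u := (ed e).1; set v := stp _ _.
  case du : (dug S u); case dv : (dug S v) => // _.
    by have [x xS /andP[h1 /negbTE h2]] := half _ _ du (negbT dv); exists x; rewrite ?h1 ?h2.
  by have [x xS /andP[h1 /negbTE h2]] := half _ _ dv (negbT du); exists x; rewrite ?h1 ?h2.
rewrite exchange_big /= mulnC -sum_nat_const; apply: leq_sum => x _.
pose s := behead (dimer_edges (val x)).
have cs e : cross (dimer (val x)) e -> e \in s.
  have bK u d : stp (bstp u d) d = u := stpK d u.
  have sK u d : bstp (stp u d) d = u := bstpK d u.
  case: e => u d; rewrite /cross /dimer /= /s /= !inE.
  have [->|ux] := eqVneq u (val x); first by case: d; rewrite ?eqxx ?orbT.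
  have [->|ux1] := eqVneq u (stp (val x) true); first by case: d; rewrite ?eqxx ?orbT.
  move=> /= /orP[] /eqP E; rewrite -(sK u d) E; case: d E; rewrite ?eqxx ?orbT// => E.
  by case/eqP: ux; rewrite -(sK u true) E sK.
rewrite sum_nat_of_bool.
rewrite cardE -(size_map (@ed r)); apply: (@leq_trans (size s)) => //.
apply: uniq_leq_size; first by rewrite (map_inj_uniq (@ed_inj r)) enum_uniq.
by move=> e /mapP[f]; rewrite mem_enum inE => cf ->; exact: cs.
Qed.

Lemma energy_dig k c S psi : S \subset flat_sites k c psi ->
  (energy (dig S psi) + 2 * neg_edges psi <=
   energy psi + 4 * r.*2.+1 + 6 * k * #|S|)%N.
Proof.
move=> SF; apply: (@leq_trans (energy psi +
  \sum_(e : bedge r) cross (inbox r) (ed e) +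
  k * \sum_(e : bedge r) cross (dug S) (ed e))%N); last first.
  apply: leq_add; first by rewrite leq_add2l mulnC card_box_boundary.
  by rewrite -[leqRHS]mulnA mulnCA leq_mul2l card_dug_boundary orbT.
rewrite /energy /neg_edges !big_distrr -!big_split /=; apply: leq_sum => e _.
exact: bcost_dig SF.
Qed.

End LowerConfig.

(** * Entropy gained by digging dimers *)

Section DigSum.
Variables (R : realType) (r k : nat) (c : 'I_3 * 'I_3) (b : R).
Hypothesis b0 : 0 <= b.
Let z := expR (- b).
Hypothesis hz2 : z ^+ 2 <= 1 / 2.
Implicit Types (psi chi : config r) (S : {set bsite r}).

Let Z := partfun r b.
Let z0 : 0 <= z. Proof. exact: expR_ge0. Qed.

Definition zero_dimers chi : {set bsite r} :=
  [set x | [&& in_class r c (val x), inbox r (stp (val x) true),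
     ext chi (val x) == 0 & ext chi (stp (val x) true) == 0]]%SET.

Lemma dug_self S (x : bsite r) : x \in S -> dug S (val x) && dug S (stp (val x) true).
Proof.
by move=> xS; apply/andP; split; apply/existsP; exists x;
  rewrite xS /dimer eqxx ?orbT.
Qed.

Lemma class_spacing psi S (x x' : bsite r) : S \subset flat_sites k c psi ->
  x' \in S -> in_class r c (val x) ->
  [/\ val x != stp (val x') true, bstp (val x) true != val x'
    & bstp (val x) true != stp (val x') true].
Proof.
move=> /fintype.subsetP SF /SF; rewrite inE => /and4P[c' _ _ _] cx.
by apply: in_class_spacing cx c' _ _; rewrite -mem_box; exact: valP.
Qed.

Lemma sub_zero_dimers psi S : S \subset flat_sites k c psi ->
  S \subset zero_dimers (dig S psi).
Proof.
move=> SF; apply/fintype.subsetP => x xS; have /andP[d1 d2] := dug_self xS.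
have := fintype.subsetP SF _ xS; rewrite !inE => /and4P[cx /flat_dimer[xr x1r _] _ _].
by rewrite !ext_dig d1 d2 xr x1r cx !eqxx.
Qed.

(** The spacing of the class excludes partial overlap with a dug dimer, so both sites of a zero
    dimer outside [S] were raised from -1 to 0. *)
Lemma card_zero_dimers psi S : S \subset flat_sites k c psi ->
  (#|zero_dimers (dig S psi) :\: S| <= neg_edges psi)%N.
Proof.
move=> SF.
rewrite /neg_edges sum_nat_of_bool.
apply: (@leq_card_rel _ _ _ _ (fun x e => ed e = (val x, true))); last first.
  by move=> x x' e _ _ -> [] /val_inj.
move=> x; rewrite !inE => /andP[xS /and4P[cx x1r /eqP e1 /eqP e2]].
have xr : inbox r (val x) by rewrite -mem_box; exact: valP.
have [f fE] : exists f : bedge r, ed f = (val x, true) by apply: ed_of; rewrite /= xr.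
exists f => //; rewrite inE /tgt /src fE /=.
have nd y : y = val x \/ y = stp (val x) true -> ~~ dug S y.
  move=> yx; apply/existsPn => x'; apply/negP => /andP[x'S].
  have [h1 h2 h3] := class_spacing SF x'S cx.
  have E : bstp (stp (val x) true) true = val x := bstpK true (val x).
  have E' : bstp (stp (val x') true) true = val x' := bstpK true (val x').
  rewrite /dimer => /orP[] /eqP yx'; case: yx => yx; rewrite yx in yx'.
  - by move: xS; rewrite (val_inj yx') x'S.
  - have := class_spacing SF x'S cx.
    have := fintype.subsetP SF _ x'S; rewrite inE => /and4P[cx' _ _ _] _.
    have x'r : inbox r (val x') by rewrite -mem_box; exact: valP.
    have [/eqP] := in_class_spacing cx' cx x'r xr.
    by rewrite yx'.
  - by rewrite yx' eqxx in h1.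
  - have xx' : val x = val x' by rewrite -E yx' E'.
    by move: xS; rewrite (val_inj xx') x'S.
have d1 := negbTE (nd _ (or_introl erefl)).
have d2 := negbTE (nd _ (or_intror erefl)).
move: e1 e2; rewrite !ext_dig xr x1r d1 d2.
by move=> /eqP; rewrite addr_eq0 => /eqP -> /eqP; rewrite addr_eq0 => /eqP ->.
Qed.

(** Undug heights are read off directly. A dug dimer was flat, hence at the height of the site to
    its left, which the class keeps undug. *)
Lemma dig_inj S :
  {in [set psi | S \subset flat_sites k c psi] &, injective (dig S : config r -> config r)}.
Proof.
move=> psi psi' /set_mem /= SF /set_mem /= SF' E; apply/ffunP => y.
have eqx u : inbox r u -> ~~ dug S u -> ext psi u = ext psi' u.
  move=> ur du; have := congr1 (fun chi => ext chi u) E.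
  by rewrite /= !ext_dig ur (negbTE du) => /addIr.
rewrite -!ext_val; have yr : inbox r (val y) by rewrite -mem_box; exact: valP.
have [dy|dy] := boolP (dug S (val y)); last exact: eqx.
move: dy => /existsP[x /andP[xS xy]].
have := fintype.subsetP SF _ xS; rewrite inE => /and4P[cx fx _ _].
have := fintype.subsetP SF' _ xS; rewrite inE => /and4P[_ fx' _ _].
have bK : stp (bstp (val x) true) true = val x := stpK true (val x).
have [wr _ wE] := flat_edge fx (isT : 1 < 7)%N.
have [_ _ wE'] := flat_edge fx' (isT : 1 < 7)%N.
rewrite /= bK in wr wE wE'.
have dw : ~~ dug S (bstp (val x) true).
  apply/existsPn => x'; apply/negP => /andP[x'S]; rewrite /dimer.
  by have [_ /negbTE -> /negbTE ->] := class_spacing SF x'S cx.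
have [_ _ x1] := flat_dimer fx; have [_ _ x1'] := flat_dimer fx'.
have ex : ext psi (val x) = ext psi' (val x) by rewrite -wE -wE' eqx.
by move: xy => /orP[] /eqP ->; rewrite ?x1 ?x1'.
Qed.

Let w := z ^+ (6 * k) / 2.

(* For a given image [chi], a zero dimer was either dug, or at height -1 and
   then [neg_edges] supplies a factor [z^2 <= 1/2]; hence the weight [2^-|zero_dimers|]
   makes the sum over [S] at most 1. *)
Lemma dig_sum :
  (tsum (fun psi => (wt b psi * (1 + w) ^+ #|flat_sites k c psi|)%R) <=
   (expR (4 * b * (r.*2.+1)%:R))%:E * Z)%E.
Proof.
have w0 : 0 <= w by rewrite divr_ge0// exprn_ge0.
have E psi : wt b psi * (1 + w) ^+ #|flat_sites k c psi| = \sum_(S : {set bsite r})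
    wt b psi * w ^+ #|S| *+ (S \subset flat_sites k c psi).
  rewrite -prodr_const prod1D_subset mulr_sumr big_mkcond; apply: eq_bigr => S _.
  by rewrite prodr_const; case: ifP => _; rewrite ?mulr0n ?mulr1n.
rewrite (eq_tsum E) tsum_sum; last first.
  by move=> S psi; rewrite mulrn_wge0// mulr_ge0 ?wt_ge0 ?exprn_ge0.
set a := (4 * r.*2.+1)%N.
pose g S chi := wt b chi * (2^-1 ^+ #|zero_dimers chi| *+ (S \subset zero_dimers chi)).
have g0 S chi : 0 <= g S chi.
  by rewrite mulr_ge0 ?wt_ge0// mulrn_wge0// exprn_ge0// invr_ge0.
have z_inv : expR (4 * b * (r.*2.+1)%:R) * z ^+ a = 1.
  by rewrite /z -expRM_natl -expRD /a natrM (_ : _ + _ = 0) ?expR0//; ring.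
apply: le_trans (_ : \sum_(S : {set bsite r})
    (expR (4 * b * (r.*2.+1)%:R))%:E * tsum (g S) <= _)%E.
  apply: lee_sum => S _; rewrite -tsumZ ?expR_ge0//.
  apply: (@le_tsum_inj _ _ _ [set psi | S \subset flat_sites k c psi] (dig S)).
  - exact: dig_inj.
  - by move=> chi; rewrite mulr_ge0// expR_ge0.
  - move=> psi /= SF; rewrite SF /g (sub_zero_dimers SF) !mulr1n.
    have le1 := energy_dig SF; have le2 := card_zero_dimers SF.
    have cZ : #|zero_dimers (dig S psi)| = (#|S| + #|zero_dimers (dig S psi) :\: S|)%N.
      by rewrite -(cardsID S) (finset.setIidPr (sub_zero_dimers SF)).
    rewrite cZ; move: le2; move: #|_ :\: S| => d le2.
    rewrite -[leLHS]mul1r -[X in X * _ <= _]z_inv -[leLHS]mulrA.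
    apply: ler_wpM2l; first exact: expR_ge0.
    rewrite /w !wtE -/z exprMn -exprM exprD !mulrA -!exprD.
    have h1 : 2^-1 ^+ #|S| >= 0 :> R by rewrite exprn_ge0// invr_ge0.
    rewrite [leRHS]mulrAC; apply: ler_wpM2r => //.
    apply: le_trans (_ : z ^+ energy (dig S psi) * z ^+ (2 * d) <= _); last first.
      apply: ler_wpM2l; first exact: exprn_ge0.
      rewrite exprM; apply: lerXn2r; rewrite ?nnegrE ?exprn_ge0 ?invr_ge0//.
      by move: hz2; rewrite mul1r.
    rewrite -exprD; apply: ler_wiXn2l => //.
      by rewrite -expR0 ler_expR oppr_le0.
    rewrite [X in (_ <= X + _)%N]addnC; apply: leq_trans le1.
    by rewrite leq_add2l leq_mul2l le2 orbT.
  - by move=> psi /= /negP/negbTE ->; rewrite mulr0n.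
rewrite -ge0_sume_distrr; last by move=> S _; exact: tsum_ge0.
apply: lee_wpmul2l; first by rewrite lee_fin expR_ge0.
rewrite -tsum_sum//; apply: le_tsum => chi.
rewrite -mulr_sumr ler_piMr ?wt_ge0//.
rewrite (eq_bigr (fun S => if S \in powerset (zero_dimers chi)
  then 2^-1 ^+ #|zero_dimers chi| else 0)); last first.
  by move=> S _; rewrite powersetE; case: ifP.
rewrite -big_mkcond sumr_const card_powerset -[leLHS]mulr_natl natrX -exprMn.
by rewrite divff// expr1n.
Qed.

End DigSum.

(** * Tail bounds for flat sites, negative bonds and energy *)

Section Tails.
Variables (R : realType) (r : nat) (b : R).
Hypothesis b0 : 0 <= b.
Let z := expR (- b).
Let Z := partfun r b.
Let side : R := (r.*2.+1)%:R.
Implicit Types (psi : config r).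

Lemma markov_mass (A : set (config r)) (K : R) (G : config r -> R) :
  0 < K -> (forall psi, 0 <= G psi) -> (forall psi, A psi -> K <= G psi) ->
  (mass b A <= (K^-1)%:E * tsum (fun psi => (wt b psi * G psi)%R))%E.
Proof.
move=> K0 G0 AK; rewrite -tsumZ ?invr_ge0 ?(ltW K0)//; last first.
  by move=> psi; rewrite mulr_ge0 ?wt_ge0.
apply: le_tsum => psi; case: (boolP (psi \in A)) => [/set_mem/AK KG|_]; last first.
  by rewrite mulr0n !mulr_ge0 ?invr_ge0 ?wt_ge0// ltW.
by rewrite mulr1n mulrCA ler_peMr ?wt_ge0// mulrC ler_pdivlMr// mul1r.
Qed.

(** Markov's inequality for the moment bounded in [dig_sum]; the rate w/4 is chosen so that e^(w/4)
    <= 1 + w/2. *)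
Lemma flat_tail k c (w t : R) : z ^+ 2 <= 1 / 2 -> 0 <= w -> w <= z ^+ (6 * k) -> 0 <= t ->
  (mass b [set psi : config r | (t <= #|flat_sites k c psi|%:R)%R] <=
   (expR (4 * b * side - w / 4 * t))%:E * Z)%E.
Proof.
move=> hz2 w0 wk t0; set v := z ^+ (6 * k) / 2.
have z0 : 0 <= z by exact: expR_ge0.
have z1 : z <= 1 by rewrite -expR0 ler_expR oppr_le0.
have v1 : v <= 1 / 2 by rewrite ler_pM2r ?invr_gt0// exprn_ile1.
have vw : w / 2 <= v by rewrite ler_pM2r ?invr_gt0.
have ev : expR (w / 4) <= 1 + v.
  have h1 : 1 - w / 4 <= expR (- (w / 4)) by exact: expR_ge1Dx.
  have h2 : expR (w / 4) * expR (- (w / 4)) = 1 by rewrite -expRD subrr expR0.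
  have h3 := expR_ge0 (w / 4).
  by move: (expR _) (expR _) h1 h2 h3 => e f; nra.
rewrite addrC expRD EFinM -muleA; apply: le_trans (_ : (expR (w / 4 * t))^-1%:E *
   tsum (fun psi => (wt b psi * (1 + v) ^+ #|flat_sites k c psi|)%R) <= _)%E.
  apply: markov_mass; first exact: expR_gt0.
    by move=> psi; rewrite exprn_ge0// addr_ge0// divr_ge0// exprn_ge0.
  move=> psi /= tF; apply: le_trans (_ : expR (w / 4) ^+ #|flat_sites k c psi| <= _).
    by rewrite -expRM_natl ler_expR mulrC ler_wpM2r// divr_ge0.
  apply: lerXn2r => //; rewrite nnegrE ?expR_ge0//.
  by rewrite addr_ge0// divr_ge0// exprn_ge0.
rewrite expRN; apply: lee_wpmul2l; first by rewrite lee_fin invr_ge0 expR_ge0.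
exact: dig_sum.
Qed.

(** Digging nothing leaves a plain raise, which costs at most 4 side and regains 2 for each negative
    bond. *)
Lemma neg_tail (K : nat) :
  (mass b [set psi : config r | (K <= neg_edges psi)%N] <=
   (expR (4 * b * side - 2 * b * K%:R))%:E * Z)%E.
Proof.
have S0 psi : finset.set0 \subset flat_sites 0 (ord0, ord0) psi by exact: finset.sub0set.
rewrite /Z /partfun -tsumZ ?expR_ge0//; last by move=> psi; exact: wt_ge0.
apply: (@le_tsum_inj _ _ _ [set psi : config r | (K <= neg_edges psi)%N] (dig finset.set0)).
- by move=> psi psi' _ _; apply: dig_inj; apply/mem_set; exact: S0.
- by move=> psi; rewrite mulr_ge0 ?expR_ge0 ?wt_ge0.
- move=> psi /= Kn; rewrite mem_set// mulr1n /wt -expRD ler_expR.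
  have := energy_dig (S0 psi); rewrite cards0 muln0 addn0 => le.
  have {}le : (energy (dig finset.set0 psi) + 2 * K <= energy psi + 4 * r.*2.+1)%N by lia.
  move: le; rewrite -(ler_nat R) !natrD !natrM -/side => le.
  by have := ler_wpM2l b0 le; lra.
- by move=> psi nA; rewrite memNset.
Qed.

(** Tilting by the exponential of b/2 times the energy turns the weight at [b] into the weight at
    b/2, whose total is bounded by [partfun_le]. *)
Lemma energy_tail (t : R) : expR (- (b / 2)) <= 1 / 2 ->
  (mass b [set psi : config r | (t <= (energy psi)%:R)%R] <=
   (expR (- (b / 2 * t)) * 4 ^+ (r.*2.+1 ^ 2))%:E)%E.
Proof.
move=> hb; apply: le_trans (_ : (expR (b / 2 * t))^-1%:E *
   tsum (fun psi => (wt b psi * expR (b / 2 * (energy psi)%:R))%R) <= _)%E.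
  apply: markov_mass; first exact: expR_gt0.
    by move=> psi; exact: expR_ge0.
  by move=> psi /= tE; rewrite ler_expR ler_wpM2l// divr_ge0.
rewrite expRN EFinM; apply: lee_wpmul2l; first by rewrite lee_fin invr_ge0 expR_ge0.
rewrite (eq_tsum (g' := wt (b / 2))) ?partfun_le ?divr_ge0// => psi.
by rewrite /wt -expRD; congr expR; lra.
Qed.

Lemma partfun_ge1 : (1%:E <= Z)%E.
Proof.
pose psi0 : config r := [ffun=> 0].
apply: le_trans (_ : (\esum_(psi in [set psi0]) (wt b psi)%:E <= _)%E).
  rewrite esum_set1 ?lee_fin ?wt_ge0// /wt (_ : energy psi0 = 0%N) ?mulr0 ?expR0//.
  have E x : ext psi0 x = 0 by rewrite /ext; case: insub => // y; rewrite ffunE.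
  by rewrite /energy big1// => e _; rewrite !E.
rewrite esum_mkcond; apply: le_esum => psi _; case: ifP => // _.
by rewrite lee_fin wt_ge0.
Qed.

End Tails.

(** * Counting the low sites *)

Lemma near_boundaryP r (s : site) : inbox r s ->
  ~~ all (fun e => inbox r e.1 && inbox r (stp e.1 e.2)) (dimer_edges s) ->
  [|| xco s == - r%:Z, xco s == r%:Z, xco s == r%:Z - 1,
      yco s == r%:Z | yco s == - r%:Z].
Proof.
case: s => a d; rewrite /inbox /dimer_edges /stp /bstp /= => sr.
apply: contraNT; rewrite !negb_or => /and5P[h1 h2 h3 h4 h5].
lia.
Qed.

Section Counting.
Variables (r k : nat) (psi : config r).

(** Five lines: the four sides of the box and the column [r - 1], where the right neighbor of the
    dimer is outside. *)
Lemma card_near_boundary :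
  (#|[set x : bsite r | ~~ all (fun e => inbox r e.1 && inbox r (stp e.1 e.2))
       (dimer_edges (val x))]%SET| <= 5 * r.*2.+1)%N.
Proof.
have -> : (5 * r.*2.+1)%N = #|[set: 'I_5 * 'I_(r.*2.+1)]%SET|.
  by rewrite cardsT card_prod !card_ord.
pose rel (x : bsite r) (p : 'I_5 * 'I_(r.*2.+1)) :=
  let a := xco (val x) in let d := yco (val x) in
  match val p.1 with
  | 0%N => a = - r%:Z /\ d = (val p.2)%:Z - r%:Z
  | 1%N => a = r%:Z /\ d = (val p.2)%:Z - r%:Z
  | 2%N => a = r%:Z - 1 /\ d = (val p.2)%:Z - r%:Z
  | 3%N => d = r%:Z /\ a = (val p.2)%:Z - r%:Z
  | _ => d = - r%:Z /\ a = (val p.2)%:Z - r%:Z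
  end.
apply: (@leq_card_rel _ _ _ _ rel); last first.
  move=> x x' [[i hi] j] _ _; rewrite /rel /= => h1 h2; apply/val_inj/site_eq; move: h1 h2;
  by case: i hi => [|[|[|[|i]]]] hi /= [h1 h2] [h3 h4];
    rewrite ?h1 ?h2 ?h3 ?h4.
move=> x; rewrite inE => nx.
have xr : inbox r (val x) by rewrite -mem_box; exact: valP.
have hb : [|| xco (val x) == - r%:Z, xco (val x) == r%:Z, xco (val x) == r%:Z - 1,
              yco (val x) == r%:Z | yco (val x) == - r%:Z].
  exact: near_boundaryP xr nx.
have hx : (absz (xco (val x) + r%:Z)%R < r.*2.+1)%N by move: xr; rewrite /inbox; lia.
have hd : (absz (yco (val x) + r%:Z)%R < r.*2.+1)%N by move: xr; rewrite /inbox; lia.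
have yE : yco (val x) = (absz (yco (val x) + r%:Z)%R)%:Z - r%:Z by move: xr; rewrite /inbox; lia.
have xE : xco (val x) = (absz (xco (val x) + r%:Z)%R)%:Z - r%:Z by move: xr; rewrite /inbox; lia.
move: hb => /or4P[/eqP h|/eqP h|/eqP h|/orP[/eqP h|/eqP h]].
- by exists (@Ordinal 5 0 isT, Ordinal hd); rewrite ?finset.in_setT.
- by exists (@Ordinal 5 1 isT, Ordinal hd); rewrite ?finset.in_setT.
- by exists (@Ordinal 5 2 isT, Ordinal hd); rewrite ?finset.in_setT.
- by exists (@Ordinal 5 3 isT, Ordinal hx); rewrite ?finset.in_setT.
- by exists (@Ordinal 5 4 isT, Ordinal hx); rewrite ?finset.in_setT.
Qed.

Lemma card_rough :
  (#|[set x : bsite r | has (fun e => ext psi e.1 != ext psi (stp e.1 e.2))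
        (dimer_edges (val x)) &
      all (fun e => inbox r e.1 && inbox r (stp e.1 e.2)) (dimer_edges (val x))]%SET|
   <= 7 * energy psi)%N.
Proof.
pose D := [set e : bedge r | ext psi (src e) != ext psi (tgt e)]%SET.
have DE : (#|D| <= energy psi)%N.
  rewrite -sum1_card big_mkcond; apply: leq_sum => e _; rewrite inE.
  case: ifP => // ne; apply: leq_trans (bcost_ge_dist _ _).
  by rewrite absz_gt0 subr_eq0.
apply: leq_trans (_ : 7 * #|D| <= _)%N; last by rewrite leq_mul2l DE.
have -> : (7 * #|D|)%N = #|finset.setX [set: 'I_7] D|.
  by rewrite cardsX cardsT card_ord.
apply: (@leq_card_rel _ _ _ _ (fun (x : bsite r) (p : 'I_7 * bedge r) =>
    ed p.2 = nth (val x, true) (dimer_edges (val x)) p.1)).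
  move=> x; rewrite inE => /andP[/(has_nthP (val x, true))[i i7 ne] /allP al].
  have /al/andP[er _] := mem_nth (val x, true) i7.
  have [|f fE] := @ed_of r (nth (val x, true) (dimer_edges (val x)) i); first by rewrite er.
  have ne' : ext psi (src f) != ext psi (tgt f) by rewrite /src /tgt fE.
  by exists (Ordinal i7, f) => //; rewrite finset.in_setX finset.in_setT inE.
move=> x x' [i f] _ _ /= -> /dimer_edges_inj E; apply/val_inj/E; exact: ltn_ord.
Qed.

(** A low site is near the boundary, or one of its seven bonds is not flat, or it is flat. In the
    flat case it is either negative together with its right neighbor, or in [flat_sites] for its own
    residue class. *)
Lemma card_low_le :
  (#|[pred x : bsite r | (pos (psi x) < k)%N]| <=
   5 * r.*2.+1 + 7 * energy psi + neg_edges psi +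
   \sum_(c : 'I_3 * 'I_3) #|flat_sites k c psi|)%N.
Proof.
pose A1 := [set x : bsite r | ~~ all (fun e => inbox r e.1 && inbox r (stp e.1 e.2))
       (dimer_edges (val x))]%SET.
pose A2 := [set x : bsite r | has (fun e => ext psi e.1 != ext psi (stp e.1 e.2))
        (dimer_edges (val x)) &
      all (fun e => inbox r e.1 && inbox r (stp e.1 e.2)) (dimer_edges (val x))]%SET.
pose A3 := [set x : bsite r | (psi x < 0) && (ext psi (stp (val x) true) < 0)]%SET.
pose A4 := (\bigcup_(c : 'I_3 * 'I_3) flat_sites k c psi)%SET.
have sub : [pred x : bsite r | (pos (psi x) < k)%N] \subset (A1 :|: A2 :|: A3 :|: A4)%SET.
  apply/fintype.subsetP => x xk; have {}xk : (pos (psi x) < k)%N := xk.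
  rewrite !finset.in_setU.
  have [//|al] := boolP (x \in A1); rewrite inE negbK in al.
  have [//|nh] := boolP (x \in A2); rewrite inE al andbT in nh.
  have fx : flat psi (val x).
    apply/allP => e ex; have /andP[-> ->] := allP al _ ex.
    by move: nh => /hasPn/(_ _ ex); rewrite negbK.
  have [_ _ x1] := flat_dimer fx.
  have [x0|x0] := ltP (psi x) 0; first by rewrite inE x1 ext_val x0.
  apply/orP; right; apply/bigcupP.
  pose m (a : int) : 'I_3 :=
    Ordinal (ltn_pmod (absz (a + r%:Z)%R) (isT : 0 < 3)%N).
  exists (m (xco (val x)), m (yco (val x))) => //; rewrite inE /in_class !eqxx fx x0 /=.
  by move: xk x0; case: (psi x) => //= a; lia.
apply: leq_trans (subset_leq_card sub) _.
apply: leq_trans (leq_card_setU _ _) _; apply: leq_add; last first.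
  rewrite /A4; elim/big_ind2: _ => //; first by rewrite cards0.
  by move=> B m C n Bm Cn; apply: leq_trans (leq_card_setU _ _) (leq_add Bm Cn).
apply: leq_trans (leq_card_setU _ _) _; apply: leq_add.
  by apply: leq_trans (leq_card_setU _ _) (leq_add card_near_boundary card_rough).
rewrite /neg_edges sum_nat_of_bool.
apply: (@leq_card_rel _ _ _ _ (fun x e => ed e = (val x, true))); last first.
  by move=> x x' e _ _ -> [] /val_inj.
move=> x; rewrite inE => /andP[x0 x1].
have xr : inbox r (val x) by rewrite -mem_box; exact: valP.
have [f fE] : exists f : bedge r, ed f = (val x, true) by apply: ed_of; rewrite /= xr.
by exists f => //; rewrite inE /tgt /src fE /= ext_val x0.
Qed.

End Counting.

(** * Numerical estimates and conclusion *)

Section Numerics.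
Variables (R : realType) (b : R).
Hypothesis b100 : 100 <= b.

Let expRN1 : expR (- 1 : R) <= 2^-1.
Proof.
have h1 : 1 + 1 <= expR 1 :> R by exact: expR_ge1Dx.
have h2 : expR 1 * expR (- 1) = 1 :> R by rewrite -expRD subrr expR0.
have h3 : 0 <= expR (- 1) :> R by exact: expR_ge0.
by move: (expR 1) (expR (- 1)) h1 h2 h3 => e f; nra.
Qed.

Let expRN_le (x : R) k : k%:R <= x -> expR (- x) <= 2^-1 ^+ k.
Proof.
move=> kx; apply: le_trans (_ : expR (- 1) ^+ k <= _).
  by rewrite -expRM_natl ler_expR mulrN1 lerN2.
by apply: lerXn2r; rewrite ?nnegrE ?expR_ge0 ?invr_ge0.
Qed.

Lemma beta_z : 2 * 128 ^+ 8 * expR (- b) <= 1.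
Proof.
(* The exponent is that of 2 * 128^8 = 2^57. *)
have h : expR (- b) <= 2^-1 ^+ 57 by apply: expRN_le; apply: le_trans b100; rewrite ler_nat.
apply: le_trans (_ : 2 * 128 ^+ 8 * 2^-1 ^+ 57 <= _); first by rewrite ler_wpM2l.
by rewrite le_eqVlt; apply/orP; left; apply/eqP; field.
Qed.

Lemma beta_z2 : expR (- b) ^+ 2 <= 1 / 2.
Proof.
have h : expR (- b) <= 2^-1 ^+ 1 by apply: expRN_le; move: b100; lra.
have h0 : 0 <= expR (- b) by exact: expR_ge0.
by move: (expR _) h h0 => e h h0; rewrite expr1 in h; nra.
Qed.

Lemma beta_half : expR (- (b / 2)) <= 1 / 2.
Proof.
have h : expR (- (b / 2)) <= 2^-1 ^+ 1 by apply: expRN_le; move: b100; lra.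
by rewrite mul1r -[leRHS]expr1.
Qed.

Lemma expR1_le4 : expR 1 <= 4 :> R.
Proof.
have h1 : 1 - 1 / 2 <= expR (- (1 / 2)) :> R by exact: expR_ge1Dx.
have h2 : expR (1 / 2) * expR (- (1 / 2)) = 1 :> R by rewrite -expRD subrr expR0.
have h3 : expR (1 / 2) * expR (1 / 2) = expR 1 :> R by rewrite -expRD; congr expR; lra.
have h4 : 0 <= expR (1 / 2) :> R by exact: expR_ge0.
have h5 : expR (1 / 2) <= 2 :> R by move: (expR (1/2)) (expR (- (1/2))) h1 h2 h4 => e f; nra.
by rewrite -h3; nra.
Qed.

(** Since side <= 2 n, this bounds the contour sum by n/(4b), half of the n/(2b) available in the
    upper tail. *)
Lemma beta_y : 512 * (expR 1 * expR (- (b / 2))) <= 1 / (4 * b).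
Proof.
have b0 : 0 < b by move: b100; lra.
have h1 : expR (- (b / 4)) <= 2^-1 ^+ 15.
  by apply: expRN_le; move: b100; lra.
have h1' : 2 ^+ 15 * expR (- (b / 4)) <= 1.
  apply: le_trans (_ : 2 ^+ 15 * 2^-1 ^+ 15 <= _).
    by apply: ler_wpM2l h1; exact: exprn_ge0.
  by rewrite le_eqVlt; apply/orP; left; apply/eqP; field.
have h2 : b / 4 * expR (- (b / 4)) <= 1.
  have h3 : 1 + b / 4 <= expR (b / 4) by exact: expR_ge1Dx.
  have h4 : expR (b / 4) * expR (- (b / 4)) = 1 by rewrite -expRD subrr expR0.
  have h5 := expR_ge0 (- (b / 4)).
  by move: (expR (b / 4)) (expR (- (b / 4))) h3 h4 h5 => e f; nra.
have -> : expR (- (b / 2)) = expR (- (b / 4)) * expR (- (b / 4)).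
  by rewrite -expRD; congr expR; lra.
rewrite ler_pdivlMr; last by rewrite mulr_gt0.
have := expR1_le4; have := expR_ge0 (1 : R); have := expR_ge0 (- (b / 4)).
move: (expR 1) (expR (- (b / 4))) h1' h2 => e f h1' h2 f0 e0 e4.
have h6 : 0 <= b * f by rewrite mulr_ge0// ltW.
have h7 : b * f <= 4 by lra.
have h8 : e * f <= 4 * f by rewrite ler_wpM2r.
have h9 : e * f * (b * f) <= 4 * f * 4 by apply: ler_pM => //; rewrite mulr_ge0.
have -> : 512 * (e * (f * f)) * (4 * b) = 2048 * (e * f * (b * f)) by ring.
lra.
Qed.

Lemma beta_128 : 128 * (expR 1 * expR (- (b / 2))) <= 1 / 2.
Proof.
have h := beta_y; have : 1 / (4 * b) <= 1.
  by rewrite ler_pdivrMr; move: b100; lra.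
lra.
Qed.

Lemma beta_32 : 32 * expR (- (2 * b)) <= 1.
Proof.
have h : expR (- (2 * b)) <= 2^-1 ^+ 5 by apply: expRN_le; move: b100; lra.
apply: le_trans (_ : 32 * 2^-1 ^+ 5 <= _); first by rewrite ler_wpM2l.
by rewrite le_eqVlt; apply/orP; left; apply/eqP; field.
Qed.

(** In the lower tail the entropy e^(4b) n/(4b) must exceed the cost 8 b n of raising, with n to
    spare. *)
Lemma beta_e4 : 4 * b * (8 * b + 1) <= expR (4 * b).
Proof.
have h : b <= expR b by apply: le_trans (expR_ge1Dx b); lra.
have b0 : 0 <= b by move: b100; lra.
have h4 : b ^+ 4 <= expR b ^+ 4 by apply: lerXn2r; rewrite ?nnegrE ?expR_ge0.
apply: le_trans (_ : b ^+ 4 <= _); last by rewrite (expRM_natl 4).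
have h2 : 100 * b <= b * b by rewrite ler_wpM2r.
have h3 : 100 * b * (100 * b) <= b * b * (b * b).
  by apply: ler_pM => //; rewrite mulr_ge0.
have -> : b ^+ 4 = b * b * (b * b) by ring.
nra.
Qed.

Variable n : nat.
Hypothesis n_large : expR (4 * b) <= n%:R.

Let n0 : 0 < n%:R :> R. Proof. exact: lt_le_trans (expR_gt0 _) n_large. Qed.

(** If x is the argument of the floor, 6 b x = ln n + 2 b, the offset 1/3 being the source of 2 b.
    One level up this leaves e^(-2b)/n; one level down, 6 b - 2 b = 4 b remains. The size of [n]
    makes x at least 1. *)
Lemma hstar_bounds : exists hs : nat, [/\ hstar b n = hs%:Z, (0 < hs)%N,
  expR (- b) ^+ (6 * hs.+1) <= expR (- (2 * b)) / n%:R &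
  expR (4 * b) / n%:R <= expR (- b) ^+ (6 * hs.-1)].
Proof.
have b0 : 0 < b by move: b100; lra.
set x := 1 / (6 * b) * ln n%:R + 1 / 3.
have lnn : 4 * b <= ln n%:R by rewrite -[leLHS]expRK ler_ln ?posrE ?expR_gt0.
have xE : 6 * b * x = ln n%:R + 2 * b by rewrite /x; field; lra.
have x1 : 1 <= x by move: lnn xE; nra.
have /andP[fl fu] := Num.Theory.floor_itv x.
have f1 : 1 <= Num.floor x.
  by rewrite Num.Theory.floor_ge_int.
exists (absz (Num.floor x)); have fE : (absz (Num.floor x))%:Z = Num.floor x by lia.
have hsE : ((absz (Num.floor x))%:R : R) = (Num.floor x)%:~R by rewrite -fE.
have hs1E : ((absz (Num.floor x)).+1%:R : R) = (Num.floor x)%:~R + 1.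
  by rewrite -hsE -natr1.
have en : expR (ln n%:R) = n%:R :> R by rewrite lnK// posrE.
split; rewrite ?fE//; first by lia.
- rewrite -expRM_natl -[in leRHS]en -expRN -expRD ler_expR natrM hs1E.
  move: fu; rewrite intrD => fu.
  have : 6 * b * x <= 6 * b * ((Num.floor x)%:~R + 1) by rewrite ler_wpM2l ?(ltW fu)// mulr_ge0// ltW.
  by rewrite xE; lra.
- rewrite -expRM_natl -[in leLHS]en -expRN -expRD ler_expR natrM.
  have -> : ((absz (Num.floor x)).-1%:R : R) = (Num.floor x)%:~R - 1.
    by rewrite -hsE -subn1 natrB//; lia.
  have : 6 * b * (Num.floor x)%:~R <= 6 * b * x by rewrite ler_wpM2l// mulr_ge0// ltW.
  by rewrite xE; lra.
Qed.

End Numerics.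

(** * The exceptional event *)

Lemma card_offlevel_le (r hs : nat) (psi : config r) :
  (#|[pred x : bsite r | (pos (psi x))%:Z \notin [:: hs%:Z - 1; hs%:Z]%R]| <=
   #|[pred x : bsite r | (hs.+1%:Z <= psi x)%R]| +
   #|[pred x : bsite r | (pos (psi x) < hs.-1)%N]|)%N.
Proof.
rewrite -cardUI; apply: leq_trans (leq_addr _ _).
apply/subset_leq_card/fintype.subsetP => x; rewrite !inE.
by case: (psi x) => a /=; lia.
Qed.

Section BadEvent.
Variables (R : realType) (b : R) (n : nat).
Hypothesis b100 : 100 <= b.
Hypothesis n_large : expR (4 * b) <= n%:R.

Let r := n./2.
Let Z := partfun r b.
Let N : R := n%:R.
Let side : R := (r.*2.+1)%:R.
Let b0 : 0 < b. Proof. by move: b100; lra. Qed.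
Let Nb : b <= N.
Proof.
apply: le_trans n_large; apply: le_trans (expR_ge1Dx _); move: b100; lra.
Qed.
Let N1 : 1 <= N. Proof. by move: b100 Nb; lra. Qed.
Let sideN : N <= side <= 2 * N.
Proof.
have n1 : (1 <= n)%N by rewrite -(ler_nat R).
by rewrite /N /side -natrM !ler_nat /r; lia.
Qed.

Definition bad : set (config r) :=
  [set psi | 200 / b * N ^+ 2 <
     #|[pred x : bsite r | (pos (psi x))%:Z \notin [:: hstar b n - 1; hstar b n]]|%:R].

Let rate := expR (- (N / (4 * b))).

Let le_rate (t : R) : t <= - (N / (4 * b)) -> ((expR t)%:E * Z <= rate%:E * Z)%E.
Proof.
move=> tN; apply: lee_wpmul2r; first by apply: tsum_ge0 => psi; exact: wt_ge0.
by rewrite lee_fin ler_expR.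
Qed.

Let Nb4 : N / (4 * b) <= N.
Proof. by rewrite ler_pdivrMr ?mulr_gt0// ler_peMr//; move: b100 N1; lra. Qed.

Lemma bad_upper hs : expR (- b) ^+ (6 * hs.+1) <= expR (- (2 * b)) / N ->
  (mass b [set psi : config r | (N ^+ 2 / b <=
      #|[pred x : bsite r | (hs.+1%:Z <= psi x)%R]|%:R)%R] <= rate%:E * Z)%E.
Proof.
move=> hz; have /andP[sN s2N] := sideN; have N0 : 0 < N by move: N1; lra.
have s0 : 0 < side by move: N1 sN; lra.
have hside : 16 * side * expR (- b) ^+ (6 * hs.+1) <= 1.
  apply: le_trans (_ : 16 * (2 * N) * (expR (- (2 * b)) / N) <= _).
    by apply: ler_pM; rewrite ?mulr_ge0 ?exprn_ge0 ?expR_ge0 ?(ltW s0)//; lra.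
  rewrite (_ : _ * _ = 32 * expR (- (2 * b))); first exact: beta_32.
  by field; rewrite ?gt_eqF.
apply: le_trans (upper_tail (ltW b0) (beta_z b100) _ hside (beta_128 b100) _) _ => //.
apply: le_rate; have hy := beta_y b100; set e := expR 1 * _ in hy *.
have h1 : N / (2 * b) <= N ^+ 2 / b / side.
  rewrite (_ : N ^+ 2 / b / side = N / (2 * b) * (2 * N / side)).
    by rewrite ler_peMr ?divr_ge0 ?mulr_ge0 ?(ltW N0) ?(ltW b0)// ler_pdivlMr// mul1r.
  move: (side) (lt0r_neq0 s0) => s sn0.
  by field; rewrite sn0 gt_eqF.
have e0 : 0 <= e by rewrite mulr_ge0 ?expR_ge0.
have h2 : side * (256 * e) <= N * (1 / (4 * b)).
  apply: le_trans (_ : 2 * N * (256 * e) <= _).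
    by apply: ler_wpM2r s2N; exact: mulr_ge0 (ler0n _ _) e0.
  rewrite (_ : 2 * N * (256 * e) = N * (512 * e)); last by ring.
  by rewrite ler_wpM2l// ltW.
have h3 : N / (2 * b) = N * (1 / (4 * b)) + N / (4 * b) by field; rewrite ?gt_eqF.
by move: h1 h2 h3; move: (N / (2 * b)) (N ^+ 2 / b / side) (N * (1 / (4 * b)))
  (side * (256 * e)) (N / (4 * b)) => *; lra.
Qed.

(** The threshold yields exp(-10 N^2), while 4^(side^2) is at most exp(2 (2 N)^2) = exp(8 N^2). *)
Lemma bad_energy :
  (mass b [set psi : config r | (20 * N ^+ 2 / b <= (energy psi)%:R)%R] <= rate%:E * Z)%E.
Proof.
have /andP[sN s2N] := sideN; have N0 : 0 < N by move: N1; lra.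
apply: le_trans (energy_tail r (ltW b0) _ (beta_half b100)) _.
apply: le_trans (_ : rate%:E * 1%:E <= _)%E; last first.
  by apply: lee_wpmul2l; [rewrite lee_fin expR_ge0|exact: partfun_ge1].
rewrite mule1 lee_fin.
have e4 : (4 : R) <= expR 2.
  have h : 1 + 1 <= expR 1 :> R by exact: expR_ge1Dx.
  rewrite (_ : expR 2 = expR 1 * expR 1 :> R); last by rewrite -expRD; congr expR; lra.
  by move: (expR 1) h => e h; nra.
apply: le_trans (_ : expR (- (b / 2 * (20 * N ^+ 2 / b))) * expR 2 ^+ (r.*2.+1 ^ 2) <= _).
  by rewrite ler_wpM2l ?expR_ge0//; apply: lerXn2r; rewrite ?nnegrE ?expR_ge0.
rewrite -expRM_natl -expRD ler_expR natrX -/side.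
rewrite (_ : b / 2 * (20 * N ^+ 2 / b) = 10 * N ^+ 2); last by field; rewrite ?gt_eqF.
have h1 : side ^+ 2 <= (2 * N) ^+ 2 by apply: lerXn2r => //; rewrite nnegrE ?mulr_ge0//; lra.
have h2 : N <= N ^+ 2 by rewrite expr2 ler_peMr// ltW.
have h3 : (2 * N) ^+ 2 = 4 * N ^+ 2 by ring.
by move: h1 h2 h3 Nb4; move: (side ^+ 2) (N ^+ 2) (N / (4 * b)) ((2 * N) ^+ 2) => *; lra.
Qed.

Lemma bad_neg :
  (mass b [set psi : config r | (3 * r.*2.+1 <= neg_edges psi)%N] <= rate%:E * Z)%E.
Proof.
have /andP[sN s2N] := sideN.
apply: le_trans (neg_tail r (ltW b0) _) _; apply: le_rate; rewrite natrM -/side.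
have h : 1 * N <= b * side by apply: ler_pM => //; move: N1 b100; lra.
by move: Nb4; move: (N / (4 * b)) => t ht; lra.
Qed.

Lemma bad_flat hs c : expR (4 * b) / N <= expR (- b) ^+ (6 * hs.-1) ->
  (mass b [set psi : config r | (N ^+ 2 / b <= #|flat_sites hs.-1 c psi|%:R)%R]
    <= rate%:E * Z)%E.
Proof.
move=> hw; have /andP[sN s2N] := sideN; have N0 : 0 < N by move: N1; lra.
apply: le_trans (@flat_tail R r b (ltW b0) hs.-1 c _ _ (beta_z2 b100) _ hw _) _.
- by rewrite divr_ge0 ?expR_ge0 ?(ltW N0).
- by rewrite divr_ge0 ?exprn_ge0 ?(ltW N0) ?(ltW b0).
apply: le_rate; rewrite -/side.
rewrite (_ : expR (4 * b) / N / 4 * (N ^+ 2 / b) = expR (4 * b) / (4 * b) * N); last first.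
  by field; rewrite ?gt_eqF.
have h1 : (8 * b + 1) * N <= expR (4 * b) / (4 * b) * N.
  rewrite ler_wpM2r ?(ltW N0)// ler_pdivlMr ?mulr_gt0// mulrC.
  exact: beta_e4.
have h2 : 4 * b * side <= 4 * b * (2 * N) by rewrite ler_wpM2l// mulr_ge0// ltW.
by move: h1 h2 Nb4; move: (_ / (4 * b) * N) (N / (4 * b)) => u t h1 h2 h3; nra.
Qed.

Lemma bad_mass : (mass b bad <= (12 * rate)%:E * Z)%E.
Proof.
have /andP[sN s2N] := sideN; have N0 : 0 < N by move: N1; lra.
have [hs [hsE hs0 hup hlow]] := hstar_bounds b100 n_large.
pose B (i : option (option (option ('I_3 * 'I_3)))) : set (config r) := match i with
  | None => [set psi | (N ^+ 2 / b <= #|[pred x : bsite r | (hs.+1%:Z <= psi x)%R]|%:R)%R]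
  | Some None => [set psi | (20 * N ^+ 2 / b <= (energy psi)%:R)%R]
  | Some (Some None) => [set psi | (3 * r.*2.+1 <= neg_edges psi)%N]
  | Some (Some (Some c)) => [set psi | (N ^+ 2 / b <= #|flat_sites hs.-1 c psi|%:R)%R]
  end.
apply: le_trans (_ : \sum_i mass b (B i) <= _)%E.
  apply: mass_sub_sum => psi bpsi; apply: contrapT => nB.
  have {}nB i : ~ B i psi.
    by move=> Bi; apply: nB; exists i; rewrite ?mem_index_enum.
  move: bpsi; rewrite /bad /= hsE => bpsi.
  have := nB None; rewrite /B /= => /negP; rewrite -ltNge => h1.
  have := nB (Some None); rewrite /B /= => /negP; rewrite -ltNge => h2.
  have := nB (Some (Some None)); rewrite /B /= => /negP; rewrite -ltnNge => h3.
  have {nB}h4 : (\sum_(c : 'I_3 * 'I_3) #|flat_sites hs.-1 c psi|)%:R <= 9 * (N ^+ 2 / b).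
    rewrite natr_sum; apply: le_trans (_ : \sum_(c : 'I_3 * 'I_3) (N ^+ 2 / b) <= _).
      apply: ler_sum => c _; have := nB (Some (Some (Some c))); rewrite /B /=.
      by move=> /negP; rewrite -ltNge => /ltW.
    by rewrite sumr_const card_prod !card_ord -[leLHS]mulr_natl.
  have h5 := leq_trans (card_offlevel_le hs psi)
    (leq_add (leqnn _) (card_low_le hs.-1 psi)).
  move: h5; rewrite -(ler_nat R) !natrD !natrM -/side => /(lt_le_trans bpsi).
  move: h3; rewrite -(ltr_nat R) natrM -/side => h3.
  have h6 : N <= N ^+ 2 / b.
    by rewrite ler_pdivlMr// expr2 ler_wpM2l// ltW.
  rewrite (_ : 200 / b * N ^+ 2 = 200 * (N ^+ 2 / b)); last by field; rewrite gt_eqF.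
  rewrite (_ : 20 * N ^+ 2 / b = 20 * (N ^+ 2 / b)) in h2; last by field; rewrite gt_eqF.
  move: h1 h2 h3 h4 h6; move: (N ^+ 2 / b) => t.
  (* With t = N^2/b and N <= t, the contributions are at most t (high sites), 10 t (boundary), 140 t
     (energy), 6 t (negative bonds) and 9 t (flat sites), in total 166 t. *)
  by move: s2N N0; move: (side) (N) => s m *; lra.
apply: le_trans (_ : \sum_(i : option (option (option ('I_3 * 'I_3)))) (rate%:E * Z) <= _)%E.
  apply: lee_sum => -[[[c|]|]|] _; [exact: bad_flat|exact: bad_neg|exact: bad_energy|
    exact: bad_upper].
rewrite -ge0_sume_distrl; last by move=> *; rewrite lee_fin expR_ge0.
(* The factor 12 counts nine residue classes and three further events. *)
rewrite sumEFin sumr_const !card_option card_prod !card_ord mulr_natl.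
by [].
Qed.

End BadEvent.

Arguments bad {R} b n _.

Definition good (R : realType) (b : R) (n : nat) : set (height n) :=
  [set phi : height n |
    #|[pred x | (phi x)%:Z \notin [:: hstar b n - 1; hstar b n]]|%:R
      <= 200 / b * n%:R ^+ 2].
Arguments good {R} b n _.

Lemma sos_prob_good (R : realType) (b : R) (n : nat) :
  100 <= b -> expR (4 * b) <= n%:R ->
  `|1 - sos_prob b (lambda_w b) (good b n)| <= 12 * expR (- (n%:R / (4 * b))).
Proof.
move=> b100 nb; have b0 : 0 < b by lra.
pose r := n./2; pose Z := partfun r b.
have Zfin : (Z < +oo)%E.
  apply: le_lt_trans (ltry _); apply: partfun_le; first exact: ltW.
  have := beta_z2 b100; have := expR_ge0 (- b).
  have := beta_z b100; move: (expR (- b)) => z h1 h0 _.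
  have h2 : 1 <= 128 ^+ 8 :> R by apply: exprn_ege1; rewrite ler1n.
  by move: (128 ^+ 8) h1 h2 => c h1 h2; nra.
have Z1 : (1%:E <= Z)%E by exact: partfun_ge1.
have totE : sos_mass b (lambda_w b) [set: height n] = Z.
  by rewrite sos_massE//; apply: eq_tsum => psi; rewrite in_setT.
pose G : set (config r) := [set psi | good b n (posfun psi : height n)].
have goodE : sos_mass b (lambda_w b) (good b n) = mass b G.
  by rewrite sos_massE.
have sumE : (mass b G + mass b (bad b n) = Z)%E.
  rewrite /mass -tsumD; try by move=> psi; exact: wtn_ge0.
  apply: eq_tsum => psi; rewrite -mulrnDr.
  have -> : (psi \in bad b n) = (psi \notin G).
    have cE : #|[pred x : bsite r | (pos (psi x))%:Z \notin [:: hstar b n - 1; hstar b n]]| =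
        #|[pred x | ((posfun psi : height n) x)%:Z \notin [:: hstar b n - 1; hstar b n]]|.
      by apply: eq_card => x; rewrite !inE ffunE.
    apply/idP/idP => [/set_mem|].
      by rewrite /bad /= cE ltNge => h; apply/negP => /set_mem; apply/negP.
    by rewrite notin_setE => h; apply/mem_set; rewrite /bad /= cE ltNge; apply/negP.
  by case: (psi \in G); rewrite ?addn0 ?add0n mulr1n.
have := bad_mass b100 nb; have G0 := mass_ge0 b G; have B0 := mass_ge0 b (bad b n).
rewrite /sos_prob totE goodE -/r -/Z; move: G0 B0 sumE Zfin Z1.
move: (mass b G) (mass b (bad b n)) (Z) => [g| |] [e| |] [z| |] //.
rewrite !lee_fin => g0 e0 [zE] _ z1 ez /=.
have zgt0 : 0 < z by exact: lt_le_trans z1.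
rewrite (_ : 1 - g / z = e / z); last by rewrite -zE; field; rewrite gt_eqF// zE.
by rewrite ger0_norm ?divr_ge0 ?(ltW zgt0)// ler_pdivrMr.
Qed.

Theorem theorem1p1 (R : realType) :
  exists C : R, 0 < C /\
  exists beta0 : R, 0 < beta0 /\
  forall beta : R, beta0 <= beta ->
    (fun n : nat =>
       sos_prob beta (lambda_w beta)
         [set phi : height n |
            #|[pred x |
                 (phi x)%:Z \notin [:: hstar beta n - 1; hstar beta n]]|%:R
            <= C / beta * n%:R ^+ 2]) @ \oo --> (1 : R).
Proof.
exists 200; split=> //; exists 100; split=> // b b100.
have b0 : 0 < b by lra.
apply/cvgrPdist_le => eps eps0; near=> n.
have n1 : expR (4 * b) <= n%:R by near: n; exact: nbhs_infty_ger.
have n2 : 48 * b / eps <= n%:R by near: n; exact: nbhs_infty_ger.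
have n0 : 0 < n%:R :> R by exact: lt_le_trans (expR_gt0 _) n1.
apply: le_trans (sos_prob_good b100 n1) _.
have h1 : 1 + n%:R / (4 * b) <= expR (n%:R / (4 * b)) by exact: expR_ge1Dx.
have t0 : 0 < n%:R / (4 * b) by rewrite divr_gt0// mulr_gt0.
(* The bound 48 b / eps on [n] is chosen for this; then 12 e^(-t) <= eps follows from e^t >= t with
   t = n/(4b). *)
have h2 : 12 <= eps * (n%:R / (4 * b)).
  rewrite mulrA ler_pdivlMr ?mulr_gt0//; move: n2; rewrite ler_pdivrMr//; lra.
rewrite expRN -ler_pdivlMr ?invr_gt0 ?expR_gt0// invrK.
by apply: le_trans h2 _; rewrite ler_wpM2l ?(ltW eps0)//; lra.
Unshelve. all: by end_near.
Qed.
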